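(* Let $\mathcal{C}$ be any concept class with probabilistic representation dimension $d$, i.e., $\mathrm{PRDim}(\mathcal{C})=d$. Then, for any sufficiently small $\alpha,\varepsilon>0$ and for all $m\in\mathbb{N}$, \[ n_m^{\mathrm{PAC}(\mathcal{C};\alpha)}(\varepsilon,\delta=0) = \tilde{\Theta}\left(\frac{d}{\varepsilon} + \frac{d}{\varepsilon\alpha m}\right). \]
   Context: User-level DP: there are $n$ users each holding $m$ examples from a domain $\mathcal{Z}$; two inputs in $\mathcal{Z}^{nm}$ are user-level neighbors if they differ only in one user's $m$ examples; an algorithm $\mathbf{A}$ with finite output set is $(\varepsilon,\delta)$-user-level DP if $\Pr[\mathbf{A}(\mathbf{x})\in S]\le e^\varepsilon\Pr[\mathbf{A}(\mathbf{x}')\in S]+\delta$ for all neighbors $\mathbf{x},\mathbf{x}'$ and all output sets $S$. For a task with correct-answer sets $\Psi(\mathcal{D})$, $n_m(\varepsilon,\delta)$ is the smallest $n$ such that some $(\varepsilon,\delta)$-user-level DP algorithm, given $nm$ i.i.d. samples from $\mathcal{D}$ grouped into $n$ users, outputs an element of $\Psi(\mathcal{D})$ with probability at least $2/3$ for every valid $\mathcal{D}$. PAC learning: $\mathcal{Z}=\mathcal{X}\times\{0,1\}$, $\mathcal{C}\subseteq\{0,1\}^{\mathcal{X}}$, $\mathrm{Err}_{\mathcal{D}}(c)=\Pr_{(x,y)\sim\mathcal{D}}[c(x)\ne y]$. In the task $\mathrm{PAC}(\mathcal{C};\alpha)$ the valid distributions are those with $\mathrm{Err}_{\mathcal{D}}(c^*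 )=0$ for some $c^*\in\mathcal{C}$, and the correct outputs are functions $c:\mathcal{X}\to\{0,1\}$ with $\mathrm{Err}_{\mathcal{D}}(c)\le\alpha$. A distribution $\mathcal{P}$ over finite sets $\mathcal{H}$ of functions $\mathcal{X}\to\{0,1\}$ is an $(\alpha,\beta)$-probabilistic representation of $\mathcal{C}$ if for every $c\in\mathcal{C}$ and every distribution $\mathcal{D}_{\mathcal{X}}$ on $\mathcal{X}$, with probability $1-\beta$ over $\mathcal{H}\sim\mathcal{P}$ there is $h\in\mathcal{H}$ with $\Pr_{x\sim\mathcal{D}_{\mathcal{X}}}[c(x)\ne h(x)]\le\alpha$. Let $\mathrm{size}(\mathcal{P})=\max_{\mathcal{H}\in\mathrm{supp}(\mathcal{P})}\log|\mathcal{H}|$, $\mathrm{PRDim}_{\alpha,\beta}(\mathcal{C})$ the minimum of $\mathrm{size}(\mathcal{P})$ over $(\alpha,\beta)$-probabilistic representations $\mathcal{P}$ of $\mathcal{C}$, and $\mathrm{PRDim}(\mathcal{C})=\mathrm{PRDim}_{1/4,1/4}(\mathcal{C})$. $\tilde{\Theta}$ hides polylogarithmic factors.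
   Formalization: The lower bound excludes classes {c, 1−c}, where a single example reveals the target and it fails as α→0; all distributions, including the probabilistic representation, have countable support, so finite PRDim forces C finite (infinite C is not learnable with a finite output set). *)

(* Defs.v *)
From HB Require Import structures.
From mathcomp Require Import all_boot all_order all_algebra finmap.
From mathcomp Require Import all_classical all_reals all_analysis.

Set Implicit Arguments.
Unset Strict Implicit.
Unset Printing Implicit Defensive.

Import Order.TTheory GRing.Theory Num.Theory.
Local Open Scope classical_set_scope.
Local Open Scope ring_scope.

(* Discrete probability distributions: the mass condition forces the support to
   be countable.  On a countable T these are all the probability distributions;
   on a finite T they are the points of the simplex. *)
Record dist (R : realType) (T : choiceType) := Dist {
  mass :> T -> R ;
  mass_ge0 : forall t, 0 <= mass t ;
  mass_sum1 : (\esum_(t in [set: T]) (mass t)%:E = 1)%E }.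

Definition pr (R : realType) (T : choiceType) (p : dist R T) (S : set T)
  : \bar R := (\esum_(t in S) (p t)%:E)%E.

(* [x i j] is the j-th example of user i. *)
Definition dataset (n m : nat) (Z : choiceType) : choiceType :=
  {ffun 'I_n -> {ffun 'I_m -> Z}}.

Definition user_neighbors (n m : nat) (Z : choiceType) (x x' : dataset n m Z) :=
  exists i : 'I_n, forall k : 'I_n, k != i -> x k = x' k.

(* A randomized algorithm has countably many possible outputs on each input.
   Finitely many would be too few when the set O of answers is infinite (no
   finite set of answers suffices to learn point functions on nat); for
   finite O nothing changes. *)
Definition algorithm (R : realType) (n m : nat) (Z O : choiceType) :=
  dataset n m Z -> dist R O.

Definition user_level_DP (R : realType) (n m : nat) (Z O : choiceType)
    (eps delta : R) (A : algorithm R n m Z O) :=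
  forall x x' : dataset n m Z, user_neighbors x x' -> forall S : set O,
    (pr (A x) S <= (expR eps)%:E * pr (A x') S + delta%:E)%E.

(* Probability that A, run on n * m i.i.d. samples from D, answers in S. *)
Definition success_pr (R : realType) (n m : nat) (Z O : choiceType)
    (A : algorithm R n m Z O) (D : dist R Z) (S : set O) : \bar R :=
  (\esum_(x in [set: dataset n m Z])
     ((\prod_(i < n) \prod_(j < m) D (x i j))%R%:E * pr (A x) S))%E.

Record task (R : realType) (Z O : choiceType) := Task {
  valid : set (dist R Z) ;
  correct : dist R Z -> set O }.

Definition solvable (R : realType) (Z O : choiceType) (T : task R Z O)
    (m : nat) (eps delta : R) (n : nat) :=
  exists A : algorithm R n m Z O, user_level_DP eps delta A /\
    forall D, valid T D -> ((2 / 3)%:E <= success_pr A D (correct T D))%E.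

(* "n_m(eps, delta) = n" for the task T; n = 0 is allowed. *)
Definition is_sample_complexity (R : realType) (Z O : choiceType)
    (T : task R Z O) (m : nat) (eps delta : R) (n : nat) :=
  solvable T m eps delta n /\
  forall n', solvable T m eps delta n' -> (n <= n')%N.

Definition Err (R : realType) (X : choiceType) (D : dist R (X * bool)%type)
    (c : X -> bool) : \bar R := pr D [set z | c z.1 != z.2].

Definition PAC (R : realType) (X : choiceType) (C : set (X -> bool)) (alpha : R)
  : task R (X * bool)%type (X -> bool) :=
  Task (fun D => exists2 c, C c & Err D c = 0%E)
       (fun D => [set c | (Err D c <= alpha%:E)%E]).

Definition prob_representation (R : realType) (X : choiceType)
    (alpha beta : R) (C : set (X -> bool)) (P : dist R {fset (X -> bool)}) :=
  forall c, C c -> forall D : dist R X,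
    ((1 - beta)%:E <=
     pr P [set H | exists2 h, h \in H & (pr D [set x | c x != h x] <= alpha%:E)%E]
    )%E.

Definition is_greatest (R : realType) (A : set R) (s : R) := A s /\ ubound A s.
Definition is_least (R : realType) (A : set R) (s : R) := A s /\ lbound A s.

(* "size(P) = s"; no s qualifies when |H| is unbounded on the support of P. *)
Definition is_size (R : realType) (X : choiceType)
    (P : dist R {fset (X -> bool)}) (s : R) :=
  is_greatest [set ln (#|` H|%:R) | H in [set H | P H != 0]] s.

Definition is_PRDim_at (R : realType) (X : choiceType)
    (alpha beta : R) (C : set (X -> bool)) (d : R) :=
  is_least [set s | exists2 P, prob_representation alpha beta C P & is_size P s] d.

Definition is_PRDim (R : realType) (X : choiceType) (C : set (X -> bool)) (d : R) :=
  is_PRDim_at (1 / 4) (1 / 4) C d.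

(* For C = {c, 1 - c} any single example identifies the target exactly, so
   n_m does not grow as alpha tends to 0, although PRDim(C) = log 2 > 0. *)
Definition complementary_pair (X : choiceType) (C : set (X -> bool)) :=
  exists c : X -> bool, C = [set c; (fun x => ~~ c x)].

(* Main.v *)
(* Lower bound: let D' put mass 1 - 4 alpha on (x0, c x0) and mass 4 alpha on a
   hard distribution D labelled by c.  By group privacy the answer on the constant
   dataset (x0, c x0) is already good for D with probability at least e^-a / 2,
   where a = O(eps min(n, alpha n m)); about e^a samples of the answers on the two
   constant datasets at x0 form a probabilistic representation, so d <= a + O(1).
   Two concepts that agree at x0 but not everywhere have disjoint sets of correct
   answers, which forces a >= 1/4 and absorbs the O(1).

   Upper bound: boosting by majority turns the (1/4, 1/4)-representation into one of
   accuracy alpha / 24 and size d polylog(1 / alpha).  On a random member H of it, run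
   the exponential mechanism with score the number of users having a misclassified
   example among the first min(m, 1 / alpha).  A bad and a good hypothesis are
   compared through the exponential moment of the difference of their scores, which
   factorizes over users; a union bound over H concludes. *)

Require Import Defs.
From HB Require Import structures.
From mathcomp Require Import all_boot all_order all_algebra finmap.
From mathcomp Require Import all_classical all_reals all_analysis.
From mathcomp Require Import lra.

Set Implicit Arguments.
Unset Strict Implicit.
Unset Printing Implicit Defensive.

Import Order.TTheory GRing.Theory Num.Theory.
Local Open Scope classical_set_scope.
Local Open Scope ring_scope.

(** * Discrete expectations *)

Lemma esumZl (R : realType) (T : choiceType) (I : set T) (c : R)
    (a : T -> \bar R) : 0 <= c -> (forall t, (0 <= a t)%E) ->
  (\esum_(t in I) (c%:E * a t) = c%:E * \esum_(t in I) a t)%E.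
Proof.
move=> c0 a0; rewrite /esum -ereal_supZl//; last first.
  by apply/set0P; exists (\sum_(x \in set0) a x)%E; exists set0 => //; exact: fsets_set0.
congr ereal_sup; apply/seteqP; split=> [_ [A fA <-]|_ [_ [A fA <-] <-]] /=.
  exists (\sum_(x \in A) a x)%E; first by exists A.
  by rewrite ge0_mule_fsumr.
by exists A => //; rewrite ge0_mule_fsumr.
Qed.

Lemma esum_swap (R : realType) (T U : choiceType) (a : T -> U -> \bar R) :
  (forall t u, (0 <= a t u)%E) ->
  (\esum_(t in [set: T]) \esum_(u in [set: U]) a t u =
   \esum_(u in [set: U]) \esum_(t in [set: T]) a t u)%E.
Proof.
move=> a0; rewrite !esum_esum//.
rewrite (reindex_esum ([set: U] `*`` (fun=> [set: T])) _ (fun x => (x.2, x.1)))//.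
split=> //= [[u t] [u' t'] _ _ [-> ->]//|[t u] _].
by exists (u, t).
Qed.

Section Expectation.
Variable R : realType.
Implicit Types T U : choiceType.

(** Meant for nonnegative [f]: the sum is then unconditional, and linearity or exchange of sums
    costs only nonnegativity. *)
Definition Ex T (p : dist R T) (f : T -> \bar R) : \bar R :=
  (\esum_(t in [set: T]) ((p t)%:E * f t))%E.

Lemma Ex_ge0 T (p : dist R T) f : (forall t, 0 <= f t)%E -> (0 <= Ex p f)%E.
Proof. by move=> f0; apply: esum_ge0 => t _; rewrite mule_ge0// lee_fin mass_ge0. Qed.

(** Restricting to the support matters for representations: the cardinality of [H] is controlled
    only where [P H != 0]. *)
Lemma le_Ex_supp T (p : dist R T) f g :
  (forall t, p t != 0 -> (f t <= g t)%E) -> (Ex p f <= Ex p g)%E.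
Proof.
move=> fg; apply: le_esum => t _; have [->|pt] := eqVneq (p t) 0.
  by rewrite !mul0e.
by rewrite lee_wpmul2l ?lee_fin ?mass_ge0// fg.
Qed.

Lemma le_Ex T (p : dist R T) f g : (forall t, f t <= g t)%E -> (Ex p f <= Ex p g)%E.
Proof. by move=> fg; apply: le_Ex_supp => t _. Qed.

Lemma eq_Ex T (p : dist R T) f g : (forall t, f t = g t) -> Ex p f = Ex p g.
Proof. by move=> fg; congr Ex; apply/funext. Qed.

Lemma ExD T (p : dist R T) f g : (forall t, 0 <= f t)%E -> (forall t, 0 <= g t)%E ->
  (Ex p (fun t => f t + g t) = Ex p f + Ex p g)%E.
Proof.
move=> f0 g0; rewrite /Ex -esumD; last 2 first.
- by move=> t _; rewrite mule_ge0// lee_fin mass_ge0.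
- by move=> t _; rewrite mule_ge0// lee_fin mass_ge0.
by apply: eq_esum => t _; rewrite ge0_muleDr.
Qed.

Lemma ExZl T (p : dist R T) (c : R) f : 0 <= c -> (forall t, 0 <= f t)%E ->
  (Ex p (fun t => c%:E * f t) = c%:E * Ex p f)%E.
Proof.
move=> c0 f0; rewrite /Ex -esumZl//; last first.
  by move=> t; rewrite mule_ge0// lee_fin mass_ge0.
by apply: eq_esum => t _; rewrite muleCA.
Qed.

Lemma Ex_cst T (p : dist R T) (c : R) : 0 <= c -> Ex p (fun=> c%:E) = c%:E.
Proof.
move=> c0; rewrite -[RHS]mule1 -[X in (_ * X)%E](mass_sum1 p) -esumZl//; last first.
  by move=> t; rewrite lee_fin mass_ge0.
by apply: eq_esum => t _; rewrite muleC.
Qed.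

Lemma Ex_sum T (p : dist R T) (I : choiceType) (r : seq I) (f : I -> T -> \bar R) :
  (forall i t, 0 <= f i t)%E ->
  (Ex p (fun t => \sum_(i <- r) f i t) = \sum_(i <- r) Ex p (f i))%E.
Proof.
move=> f0; rewrite /Ex -esum_sum//; last first.
  by move=> t i _ _; rewrite mule_ge0// lee_fin mass_ge0.
by apply: eq_esum => t _; rewrite ge0_sume_distrr.
Qed.

Lemma Ex_swap T U (p : dist R T) (q : dist R U) (f : T -> U -> \bar R) :
  (forall t u, 0 <= f t u)%E ->
  Ex p (fun t => Ex q (f t)) = Ex q (fun u => Ex p (f^~ u)).
Proof.
move=> f0; rewrite /Ex.
under eq_esum => t _.
  rewrite -esumZl ?mass_ge0//; last by move=> u; rewrite mule_ge0// lee_fin mass_ge0.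
  over.
rewrite esum_swap; last by move=> t u; rewrite !mule_ge0// lee_fin mass_ge0.
apply: eq_esum => u _; rewrite -esumZl ?mass_ge0//; last first.
  by move=> t; rewrite mule_ge0// lee_fin mass_ge0.
by apply: eq_esum => t _; rewrite muleCA.
Qed.

Lemma pr_Ex T (p : dist R T) (S : set T) : pr p S = Ex p (fun t => (\1_S t)%:E).
Proof.
rewrite /pr /Ex esum_mkcond; apply: eq_esum => t _; rewrite indicE.
by case: (t \in S); rewrite ?mule1 ?mule0.
Qed.

Lemma pr_ge0 T (p : dist R T) (S : set T) : (0 <= pr p S)%E.
Proof. by apply: esum_ge0 => t _; rewrite lee_fin mass_ge0. Qed.

Lemma pr_setT T (p : dist R T) : pr p [set: T] = 1%E.
Proof. exact: mass_sum1. Qed.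

Lemma le_pr T (p : dist R T) (A B : set T) : A `<=` B -> (pr p A <= pr p B)%E.
Proof.
move=> AB; rewrite !pr_Ex; apply: le_Ex => t; rewrite lee_fin !indicE.
by rewrite ler_nat; case: (boolP (t \in A)) => // /set_mem/AB/mem_set ->.
Qed.

Lemma pr_le1 T (p : dist R T) (S : set T) : (pr p S <= 1)%E.
Proof. by rewrite -(pr_setT p); apply: le_pr. Qed.

Lemma pr_fin T (p : dist R T) (S : set T) : pr p S \is a fin_num.
Proof.
by rewrite ge0_fin_numE ?pr_ge0// (le_lt_trans (pr_le1 p S))// ltry.
Qed.

Lemma pr_fineK T (p : dist R T) (S : set T) : (fine (pr p S))%:E = pr p S.
Proof. by rewrite fineK// pr_fin. Qed.

Lemma pr_setU_le T (p : dist R T) (A B : set T) :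
  (pr p (A `|` B) <= pr p A + pr p B)%E.
Proof.
rewrite !pr_Ex -ExD; [|by move=> t; rewrite lee_fin..].
apply: le_Ex => t; rewrite -EFinD lee_fin !indicE in_setU -natrD ler_nat.
by case: (t \in A); case: (t \in B).
Qed.

Lemma pr_setC T (p : dist R T) (A : set T) : (pr p A + pr p (~` A) = 1)%E.
Proof.
rewrite !pr_Ex -ExD; [|by move=> t; rewrite lee_fin..].
rewrite -(Ex_cst p ler01); apply: eq_Ex => t.
by rewrite -EFinD !indicE in_setC -natrD; case: (t \in A).
Qed.

Lemma pr_disjoint_le1 T (p : dist R T) (A B : set T) :
  A `&` B = set0 -> (pr p A + pr p B <= 1)%E.
Proof.
move=> AB; rewrite -(pr_setC p A) leeD2l// le_pr// => t Bt At.
by have : (A `&` B) t by []; rewrite AB.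
Qed.

Lemma mass_le1 T (p : dist R T) t : p t <= 1.
Proof.
rewrite -lee_fin; apply: le_trans (pr_le1 p [set t]).
by rewrite /pr esum_set1// lee_fin mass_ge0.
Qed.

Lemma exists_supp T (p : dist R T) : exists t, p t != 0.
Proof.
apply/not_existsP => p0; have : pr p setT = 0%E.
  by apply: esum1 => t _; have /negP := p0 t; rewrite negbK => /eqP ->.
by rewrite pr_setT => /eqP; rewrite onee_eq0.
Qed.

Lemma ret_sum1 T (t0 : T) :
  (\esum_(t in [set: T]) ((t == t0)%:R : R)%:E = 1)%E.
Proof.
rewrite -[RHS](@esum_set1 R T t0 (fun=> 1%E))// [RHS]esum_mkcond.
apply: eq_esum => t _; rewrite in_set1.
by case: (t == t0).
Qed.

Definition dret T (t0 : T) : dist R T :=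
  Dist (fun t => ler0n R (t == t0)) (ret_sum1 t0).

Lemma Ex_dret T (t0 : T) f : (forall t, 0 <= f t)%E -> Ex (dret t0) f = f t0.
Proof.
move=> f0; rewrite -[RHS](@esum_set1 R T t0 f)// [RHS]esum_mkcond.
apply: eq_esum => t _; rewrite in_set1 /=.
by case: (t == t0); rewrite ?mul1e ?mul0e.
Qed.

Lemma bind_mass_fin T U (p : dist R T) (k : T -> dist R U) u :
  Ex p (fun t => (k t u)%:E) \is a fin_num.
Proof.
rewrite ge0_fin_numE; last by apply: Ex_ge0 => t; rewrite lee_fin mass_ge0.
apply: (@le_lt_trans _ _ (Ex p (fun=> 1%:E))); last by rewrite Ex_cst// ltry.
by apply: le_Ex => t; rewrite lee_fin mass_le1.
Qed.

Lemma bind_ge0 T U (p : dist R T) (k : T -> dist R U) u :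
  0 <= fine (Ex p (fun t => (k t u)%:E)).
Proof. by rewrite fine_ge0// Ex_ge0// => t; rewrite lee_fin mass_ge0. Qed.

Lemma esum_bind T U (p : dist R T) (k : T -> dist R U) (f : U -> \bar R) :
  (forall u, 0 <= f u)%E ->
  (\esum_(u in [set: U]) ((fine (Ex p (fun t => (k t u)%:E)))%:E * f u) =
   Ex p (fun t => Ex (k t) f))%E.
Proof.
move=> f0.
have m0 t u : (0 <= (p t)%:E * (k t u)%:E)%E by rewrite mule_ge0 ?lee_fin ?mass_ge0.
transitivity (\esum_(u in [set: U]) \esum_(t in [set: T])
    ((p t)%:E * ((k t u)%:E * f u)))%E.
  apply: eq_esum => u _; rewrite fineK ?bind_mass_fin//.
  (* The value [+oo] is treated apart: both sides vanish if [u] has mass zero, and otherwise some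
     [t] reaches [u] and makes both infinite. *)
  have := f0 u; case: (f u) => [r r0|_|//]; last first.
    have [E0|E0] := eqVneq (Ex p (fun t => (k t u)%:E)) 0%E.
      rewrite E0 mul0e esum1// => t _; rewrite muleA.
      suff -> : ((p t)%:E * (k t u)%:E = 0)%E by rewrite mul0e.
      apply/eqP; rewrite eq_le m0 andbT -E0.
      rewrite -(@esum_set1 R T t (fun t => (p t)%:E * (k t u)%:E)%E)// [leLHS]esum_mkcond.
      by apply: le_esum => s _; case: ifP.
    have E1 : (0 < Ex p (fun t => (k t u)%:E))%E.
      by rewrite lt0e E0 Ex_ge0// => t; rewrite lee_fin mass_ge0.
    have [t pt] : exists t, ((p t)%:E * (k t u)%:E != 0)%E.
      apply/not_existsP => h; move/eqP: E0; apply; apply: esum1 => t _.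
      by have /negP := h t; rewrite negbK => /eqP.
    rewrite gt0_muley//; apply/esym/eqP; rewrite -leye_eq.
    rewrite -[leLHS](@gt0_muley _ ((p t)%:E * (k t u)%:E)%E); last by rewrite lt0e pt m0.
    rewrite -muleA -(@esum_set1 R T t (fun t => (p t)%:E * ((k t u)%:E * +oo))%E); last first.
      by rewrite muleA mule_ge0.
    rewrite [leLHS]esum_mkcond; apply: le_esum => s _; case: ifP => // _.
    by rewrite muleA mule_ge0.
  rewrite muleC -ExZl//; last by move=> t; rewrite lee_fin mass_ge0.
  by apply: eq_esum => t _; congr (_ * _)%E; rewrite muleC.
rewrite esum_swap; last by move=> u t; rewrite muleA mule_ge0.
apply: eq_esum => t _; rewrite -esumZl ?mass_ge0// => u.
by rewrite mule_ge0// lee_fin mass_ge0.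
Qed.

Lemma bind_sum1 T U (p : dist R T) (k : T -> dist R U) :
  (\esum_(u in [set: U]) (fine (Ex p (fun t => (k t u)%:E)))%:E = 1)%E.
Proof.
rewrite -(Ex_cst p ler01).
transitivity (Ex p (fun t => Ex (k t) (fun=> 1%:E))).
  by rewrite -esum_bind//; apply: eq_esum => u _; rewrite mule1.
by apply: eq_Ex => t; rewrite Ex_cst.
Qed.

Definition dbind T U (p : dist R T) (k : T -> dist R U) : dist R U :=
  Dist (bind_ge0 p k) (bind_sum1 p k).

Lemma Ex_dbind T U (p : dist R T) (k : T -> dist R U) f :
  (forall u, 0 <= f u)%E -> Ex (dbind p k) f = Ex p (fun t => Ex (k t) f).
Proof. exact: esum_bind. Qed.

Lemma pr_dbind T U (p : dist R T) (k : T -> dist R U) S :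
  pr (dbind p k) S = Ex p (fun t => pr (k t) S).
Proof.
rewrite pr_Ex Ex_dbind; last by move=> u; rewrite lee_fin.
by apply: eq_Ex => t; rewrite pr_Ex.
Qed.

Lemma dbind_supp T U (p : dist R T) (k : T -> dist R U) u :
  dbind p k u != 0 -> exists t, p t != 0 /\ k t u != 0.
Proof.
move=> h; apply/not_existsP => n; move/eqP: h; apply => /=.
rewrite /Ex esum1// => t _; have [->|pt] := eqVneq (p t) 0; first by rewrite mul0e.
have [->|kt] := eqVneq (k t u) 0; first by rewrite mule0.
by case: (n t).
Qed.

Lemma dret_supp T (t0 t : T) : dret t0 t != 0 -> t = t0.
Proof. by rewrite /= pnatr_eq0 eqb0 negbK => /eqP. Qed.

Arguments dret : simpl never.
Arguments dbind : simpl never.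

Definition dmap T U (g : T -> U) (p : dist R T) : dist R U :=
  dbind p (fun t => dret (g t)).

Lemma Ex_dmap T U (g : T -> U) (p : dist R T) f :
  (forall u, 0 <= f u)%E -> Ex (dmap g p) f = Ex p (fun t => f (g t)).
Proof. by move=> f0; rewrite Ex_dbind//; apply: eq_Ex => t; rewrite Ex_dret. Qed.

Lemma pr_dmap T U (g : T -> U) (p : dist R T) S :
  pr (dmap g p) S = pr p [set t | S (g t)].
Proof. by rewrite !pr_Ex Ex_dmap// => u; rewrite lee_fin. Qed.

Lemma dmap_supp T U (g : T -> U) (p : dist R T) u :
  dmap g p u != 0 -> exists2 t, p t != 0 & u = g t.
Proof. by move=> /dbind_supp[t [pt /dret_supp ->]]; exists t. Qed.

End Expectation.

Arguments dret : simpl never.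
Arguments dbind : simpl never.
Arguments dmap : simpl never.

(** * Product distributions and mixtures *)

Section Product.
Variable R : realType.
Implicit Types T : choiceType.

Definition fcons T n (z : T * {ffun 'I_n -> T}) : {ffun 'I_n.+1 -> T} :=
  [ffun i => if unlift ord0 i is Some j then z.2 j else z.1].

Lemma fcons0 T n (z : T * {ffun 'I_n -> T}) : fcons z ord0 = z.1.
Proof. by rewrite ffunE unlift_none. Qed.

Lemma fconsS T n (z : T * {ffun 'I_n -> T}) j : fcons z (lift ord0 j) = z.2 j.
Proof. by rewrite ffunE liftK. Qed.

Lemma fcons_bij T n : set_bij [set: T * {ffun 'I_n -> T}] [set: _] (@fcons T n).
Proof.
split=> //= [[t x] [t' x'] _ _ e|y _].
  congr pair; first by have := congr1 (fun y : {ffun _ -> _} => y ord0) e; rewrite !fcons0.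
  apply/ffunP => j.
  by have := congr1 (fun y : {ffun _ -> _} => y (lift ord0 j)) e; rewrite !fconsS.
exists (y ord0, [ffun j => y (lift ord0 j)]) => //.
by apply/ffunP => i; rewrite ffunE; case: unliftP => [j|] -> //=; rewrite ffunE.
Qed.

(** Independence: peeling off the first coordinate with [fcons] turns the sum over functions into an
    iterated sum. *)
Lemma esum_ffun_prod T n (f : 'I_n -> T -> R) (e : 'I_n -> R) :
  (forall i t, 0 <= f i t) ->
  (forall i, (\esum_(t in [set: T]) (f i t)%:E = (e i)%:E)%E) ->
  (\esum_(x in [set: {ffun 'I_n -> T}]) (\prod_(i < n) f i (x i))%:E =
   (\prod_(i < n) e i)%:E)%E.
Proof.
elim: n f e => [|n IH] f e f0 fe.
  have x0 : {ffun 'I_0 -> T} by apply: finfun => -[].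
  rewrite (_ : [set: _] = [set x0]); last first.
    by apply/seteqP; split=> // x _; apply/ffunP => -[].
  by rewrite esum_set1 ?big_ord0// lee_fin.
have e0 i : 0 <= e i.
  by rewrite -lee_fin -fe; apply: esum_ge0 => t _; rewrite lee_fin.
rewrite (reindex_esum _ _ _ _ (@fcons_bij T n)).
transitivity (\esum_(t in [set: T]) \esum_(x in [set: {ffun 'I_n -> T}])
    (f ord0 t * \prod_(i < n) f (lift ord0 i) (x i))%:E)%E.
  rewrite esum_esum; last by move=> t x _ _; rewrite lee_fin mulr_ge0// prodr_ge0.
  rewrite (_ : _ `*`` _ = setT); last by apply/seteqP; split.
  apply: eq_esum => z _; rewrite big_ord_recl fcons0.
  by under eq_bigr do rewrite fconsS.
under eq_esum => t _.
  under eq_esum do rewrite EFinM.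
  rewrite esumZl//; last by move=> x; rewrite lee_fin prodr_ge0.
  rewrite (IH (fun i => f (lift ord0 i)) (fun i => e (lift ord0 i)))// muleC.
  over.
rewrite esumZl ?prodr_ge0//; last by move=> t; rewrite lee_fin.
by rewrite fe -EFinM big_ord_recl mulrC.
Qed.

Lemma diid_ge0 T n (p : dist R T) (x : {ffun 'I_n -> T}) : 0 <= \prod_(i < n) p (x i).
Proof. by rewrite prodr_ge0// => i _; exact: mass_ge0. Qed.

Lemma diid_sum1 T n (p : dist R T) :
  (\esum_(x in [set: {ffun 'I_n -> T}]) (\prod_(i < n) p (x i))%:E = 1)%E.
Proof.
rewrite (@esum_ffun_prod T n (fun=> p) (fun=> 1)).
- by rewrite big1.
- by move=> _ t; exact: mass_ge0.
- by move=> _; exact: mass_sum1.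
Qed.

Definition diid T n (p : dist R T) : dist R {ffun 'I_n -> T} :=
  Dist (@diid_ge0 T n p) (@diid_sum1 T n p).

Lemma Ex_diid_prod T n (p : dist R T) (f : 'I_n -> T -> R) (e : 'I_n -> R) :
  (forall i t, 0 <= f i t) ->
  (forall i, Ex p (fun t => (f i t)%:E) = (e i)%:E) ->
  Ex (diid n p) (fun x => (\prod_(i < n) f i (x i))%:E) = (\prod_(i < n) e i)%:E.
Proof.
move=> f0 fe; rewrite -(@esum_ffun_prod T n (fun i t => p t * f i t))//.
- by apply: eq_esum => x _; rewrite -EFinM big_split.
- by move=> i t; rewrite mulr_ge0// mass_ge0.
Qed.

(** The form used for the exponential moments of both bounds; the real bound [e i] also makes each
    expectation finite. *)
Lemma Ex_diid_prod_le T n (p : dist R T) (f : 'I_n -> T -> R) (e : 'I_n -> R) :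
  (forall i t, 0 <= f i t) ->
  (forall i, (Ex p (fun t => (f i t)%:E) <= (e i)%:E)%E) ->
  (Ex (diid n p) (fun x => (\prod_(i < n) f i (x i))%:E) <= (\prod_(i < n) e i)%:E)%E.
Proof.
move=> f0 fe.
have E0 i : (0 <= Ex p (fun t => (f i t)%:E))%E by apply: Ex_ge0 => t; rewrite lee_fin.
have Efin i : Ex p (fun t => (f i t)%:E) \is a fin_num.
  by rewrite ge0_fin_numE// (le_lt_trans (fe i))// ltry.
rewrite (@Ex_diid_prod T n p f (fun i => fine (Ex p (fun t => (f i t)%:E))))//; last first.
  by move=> i; rewrite fineK.
rewrite lee_fin; apply: ler_prod => i _; rewrite fine_ge0//=.
by rewrite -lee_fin fineK.
Qed.

(** True by conversion: the double product in [success_pr] is the mass of the nested [diid]. *)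
Lemma success_prE n m (Z O : choiceType) (A : algorithm R n m Z O) D S :
  success_pr A D S = Ex (diid n (diid m D)) (fun x => pr (A x) S).
Proof. by []. Qed.

Lemma dmix_ge0 T (r : R) (p q : dist R T) t : 0 <= r <= 1 ->
  0 <= (1 - r) * p t + r * q t.
Proof.
by case/andP=> r0 r1; rewrite addr_ge0// mulr_ge0 ?mass_ge0// subr_ge0.
Qed.

Lemma esum_mix T (r : R) (p q : dist R T) f : 0 <= r <= 1 ->
  (forall t, 0 <= f t)%E ->
  (\esum_(t in [set: T]) (((1 - r) * p t + r * q t)%:E * f t) =
   (1 - r)%:E * Ex p f + r%:E * Ex q f)%E.
Proof.
case/andP=> r0 r1 f0; have r1' : 0 <= 1 - r by rewrite subr_ge0.
rewrite /Ex -!esumZl//; [|by move=> t; rewrite mule_ge0 ?lee_fin ?mass_ge0..].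
rewrite -esumD; [|by move=> t _; rewrite !mule_ge0 ?lee_fin ?mass_ge0..].
apply: eq_esum => t _; rewrite !muleA -!EFinM EFinD ge0_muleDl//;
  by rewrite lee_fin mulr_ge0// mass_ge0.
Qed.

Lemma dmix_sum1 T (r : R) (p q : dist R T) : 0 <= r <= 1 ->
  (\esum_(t in [set: T]) ((1 - r) * p t + r * q t)%:E = 1)%E.
Proof.
move=> r01; under eq_esum do rewrite -[X in X%:E]mulr1 EFinM.
rewrite esum_mix// !Ex_cst// !mule1 -EFinD; congr EFin; lra.
Qed.

Definition dmix T (r : R) (r01 : 0 <= r <= 1) (p q : dist R T) : dist R T :=
  Dist (fun t => dmix_ge0 p q t r01) (dmix_sum1 p q r01).

Lemma Ex_dmix T (r : R) (r01 : 0 <= r <= 1) (p q : dist R T) f :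
  (forall t, 0 <= f t)%E ->
  (Ex (dmix r01 p q) f = (1 - r)%:E * Ex p f + r%:E * Ex q f)%E.
Proof. exact: esum_mix. Qed.

Lemma pr_dmix T (r : R) (r01 : 0 <= r <= 1) (p q : dist R T) S :
  (pr (dmix r01 p q) S = (1 - r)%:E * pr p S + r%:E * pr q S)%E.
Proof. by rewrite !pr_Ex Ex_dmix// => t; rewrite lee_fin. Qed.

End Product.

Arguments diid : simpl never.
Arguments dmix : simpl never.

(** * Independent copies of a representation *)

Section Union.
Variables (R : realType) (O : choiceType).
Implicit Types (P : dist R {fset O}) (B : set O).

Definition hit B : set {fset O} := [set H | exists2 h, h \in H & B h].

(** The law of the union of [r] independent draws from [P]. *)
Fixpoint dunion r P : dist R {fset O} :=
  if r is r1.+1 then dbind P (fun H => dmap (fun G => (H `|` G)%fset) (dunion r1 P))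
  else dret R fset0.

Lemma dunion_card r P M : (forall H, P H != 0 -> (#|` H| <= M)%N) ->
  forall H, dunion r P H != 0 -> (#|` H| <= r * M)%N.
Proof.
move=> PM; elim: r => [|r IH] H; rewrite [dunion _ _]/=.
  by move=> /dret_supp ->; rewrite cardfs0.
move=> h; have [K [PK h2]] := dbind_supp h.
have [G GM ->] := dmap_supp h2.
by rewrite mulSn cardfsU (leq_trans (leq_subr _ _))// leq_add ?PM ?IH.
Qed.

(** The union avoids [B] only if every one of the independent draws does. *)
Lemma dunion_miss r P B (b : R) : 0 <= b -> (pr P (~` hit B) <= b%:E)%E ->
  (pr (dunion r P) (~` hit B) <= (b ^+ r)%:E)%E.
Proof.
move=> b0 Pb; elim: r => [|r IH]; rewrite [dunion _ _]/=; first by rewrite expr0 pr_le1.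
rewrite pr_dbind; under eq_Ex do rewrite pr_dmap.
apply: (@le_trans _ _ (Ex P (fun H => (b ^+ r)%:E * (\1_(~` hit B) H)%:E))%E).
  apply: le_Ex => H; rewrite indicE; case: (boolP (H \in ~` hit B)) => [_|].
    rewrite mule1; apply: le_trans IH; apply: le_pr => G /= nHG [h hG Bh].
    by apply: nHG; exists h => //; rewrite in_fsetU hG orbT.
  rewrite in_setC negbK mule0 => /set_mem[h hH Bh].
  rewrite (_ : [set t | _] = set0) ?/pr ?esum_set0//.
  rewrite -subset0 => G /=; apply; exists h => //; by rewrite in_fsetU hH.
rewrite ExZl ?exprn_ge0//.
by rewrite -pr_Ex exprSr EFinM lee_wpmul2l// lee_fin exprn_ge0.
Qed.

End Union.

(** * Representations of bounded size and the representation dimension *)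

Lemma pr_setC_le (R : realType) (T : choiceType) (p : dist R T) (S : set T) (b : R) :
  ((1 - b)%:E <= pr p S)%E = (pr p (~` S) <= b%:E)%E.
Proof.
have := pr_setC p S; rewrite -(pr_fineK p S) -(pr_fineK p (~` S)) -EFinD !lee_fin => -[] e.
by apply/idP/idP; lra.
Qed.

Lemma le_ln_nat (R : realType) (i j : nat) : (i <= j)%N -> ln (i%:R : R) <= ln j%:R.
Proof.
case: i => [|i] ij; last by rewrite ler_ln ?posrE ?ltr0n ?ler_nat// (leq_trans _ ij).
rewrite ln0//; case: j {ij} => [|j]; first by rewrite ln0.
by rewrite ln_ge0// ler1n.
Qed.

Lemma hitE (R : realType) (X : choiceType) (c : X -> bool) (D : dist R X) (a : R) :
  [set H : {fset (X -> bool)} |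
     exists2 h, h \in H & (pr D [set x | c x != h x] <= a%:E)%E] =
  hit [set h | (pr D [set x | c x != h x] <= a%:E)%E].
Proof. by []. Qed.

Lemma PRDim_le (R : realType) (X : choiceType) (C : set (X -> bool)) (d : R)
    (P : dist R {fset (X -> bool)}) (M : nat) :
  is_PRDim C d -> prob_representation (1 / 4) (1 / 4) C P ->
  (forall H, P H != 0 -> (#|` H| <= M)%N) -> d <= ln M%:R.
Proof.
move=> [_ dmin] Prep PM; have [H0 PH0] := exists_supp P.
(* [is_size] asks for an attained maximum; it is the largest cardinality on the support, which is
   nonempty and bounded by [M]. *)
have exk : exists k, `[< exists2 H, P H != 0 & #|` H| = k >].
  by exists #|` H0|; apply/asboolP; exists H0.
have ubk k : `[< exists2 H, P H != 0 & #|` H| = k >] -> (k <= M)%N.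
  by move=> /asboolP[H /PM + <-].
case: (ex_maxnP exk ubk) => k /asboolP[H PH Hk] kmax.
apply: (@le_trans _ _ (ln k%:R)); last by rewrite le_ln_nat// -Hk PM.
apply: dmin; exists P => //; split; first by exists H => //; rewrite Hk.
move=> _ [G PG <-]; apply: le_ln_nat; apply: kmax.
by apply/asboolP; exists G.
Qed.

Lemma PRDim_repr (R : realType) (X : choiceType) (C : set (X -> bool)) (d : R) :
  is_PRDim C d -> exists (N : nat) (P : dist R {fset (X -> bool)}),
    [/\ (0 < N)%N, d = ln N%:R, prob_representation (1 / 4) (1 / 4) C P &
        forall H, P H != 0 -> (#|` H| <= N)%N].
Proof.
(* By convention [ln 0 = 0 = ln 1], so an empty extremal [H] leaves room for sets of cardinality 1;
   [maxn 1] covers this. *)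
move=> [[P Prep [[H PH Hd] dub]] _]; exists (maxn 1 #|` H|), P; split=> //.
- by rewrite leq_maxl.
- rewrite -Hd; case: #|` H| => [|k]; last by rewrite (maxn_idPr _).
  by rewrite ln0// maxn0 ln1.
move=> G PG; rewrite leqNgt; apply/negP; rewrite gtn_max => /andP[G1 GH].
have : ln (#|` G|%:R : R) <= d by apply: dub; exists G.
rewrite -Hd leNgt => /negP; apply; case: (#|` H|) GH => [|k] GH.
  by rewrite ln0// ln_gt0// ltr1n.
by rewrite ltr_ln ?posrE ?ltr0n ?ltr_nat// (leq_trans _ GH).
Qed.

Lemma PRDim_subsingleton (R : realType) (X : choiceType) (C : set (X -> bool)) (d : R) c0 :
  is_PRDim C d -> C `<=` [set c0] -> d <= 0.
Proof.
move=> dimC Cc; rewrite -(@ln1 R).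
apply: (@PRDim_le R X C d (dret R [fset c0]%fset) 1%N dimC); last first.
  by move=> H /dret_supp ->; rewrite cardfs1.
move=> c /Cc -> D; rewrite pr_Ex Ex_dret; last by move=> t; rewrite lee_fin.
rewrite indicE mem_set/=; first by rewrite lee_fin; lra.
exists c0; first by rewrite in_fset1.
rewrite (_ : [set x | _] = set0); first by rewrite /pr esum_set0 lee_fin; lra.
by rewrite -subset0 => x /=; rewrite eqxx.
Qed.

(** A rational substitute for exponential decay: [(1 - p) ^+ k] is at most [1 / (1 + k p)]. *)
Lemma bernoulli_inv (R : realType) (p : R) k : 0 <= p <= 1 ->
  (1 - p) ^+ k * (1 + k%:R * p) <= 1.
Proof.
case/andP=> p0 p1; elim: k => [|k IH]; first by rewrite expr0 mul0r; lra.
have E0 : 0 <= (1 - p) ^+ k by rewrite exprn_ge0// subr_ge0.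
have k0 : 0 <= k%:R :> R by [].
apply: le_trans IH; rewrite exprSr -mulrA ler_wpM2l// -natr1.
set K := k%:R in k0 *; nra.
Qed.

(* The representation is the set of about [12 e ^ a] independent samples of [q]. *)
Lemma PRDim_sample (R : realType) (X : choiceType) (C : set (X -> bool)) (d a : R)
    (q : dist R (X -> bool)) : 0 <= a -> is_PRDim C d ->
  (forall c, C c -> forall D : dist R X,
     ((expR (- a) / 3)%:E <= pr q [set h | pr D [set x | c x != h x] <= (1 / 4)%:E])%E) ->
  d <= a + ln 13.
Proof.
move=> a0 dimC qC; have ea : 1 <= expR a by rewrite -expR0 ler_expR.
(* One draw is good with probability [p >= expR (- a) / 3], so [k p >= 4]; already [k p >= 3] bounds
   the miss probability by [1 / (1 + 3)]. Rounding adds at most [1 <= expR a], whence 13. *)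
pose k := (Num.truncn (12 * expR a)).+1.
have k1 : 12 * expR a <= k%:R by rewrite ltW// truncnS_gt.
have k2 : k%:R <= 13 * expR a.
  rewrite -[leLHS]natr1; have : (Num.truncn (12 * expR a))%:R <= 12 * expR a.
    by rewrite truncn_le mulr_ge0// expR_ge0.
  by move=> ?; lra.
have kpos : 0 < k%:R :> R by rewrite ltr0n.
apply: (@le_trans _ _ (ln k%:R)); last first.
  rewrite -[X in X + _](expRK a) -lnM ?posrE ?expR_gt0//.
  by rewrite ler_ln ?posrE// ?mulr_gt0 ?expR_gt0// mulrC.
pose P := dunion k (dmap (fun h => [fset h]%fset) q).
apply: (@PRDim_le R X C d P k dimC).
- move=> c Cc D; rewrite hitE pr_setC_le.
  set B := [set h | _]; have := qC c Cc D; rewrite -/B => qB.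
  set p := fine (pr q B).
  have pE : pr q B = p%:E by rewrite pr_fineK.
  rewrite pE lee_fin in qB.
  have p01 : 0 <= p <= 1.
    by rewrite -!lee_fin -pE pr_ge0 pr_le1.
  apply: (@le_trans _ _ ((1 - p) ^+ k)%:E).
    apply: dunion_miss; first by rewrite subr_ge0; case/andP: p01.
    rewrite -pr_setC_le opprB addrC subrK -pE pr_dmap; apply: le_pr => h Bh.
    by exists h => //; rewrite in_fset1.
  rewrite lee_fin; have := bernoulli_inv k p01.
  have kp : 3 <= k%:R * p.
    apply: (@le_trans _ _ ((12 * expR a) * (expR (- a) / 3))); last first.
      by apply: ler_pM => //; rewrite ?mulr_ge0 ?expR_ge0// invr_ge0.
    have := expRxMexpNx_1 a; set u := expR a; set v := expR (- a) => uv.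
    have -> : 12 * u * (v / 3) = 4 * (u * v) by lra.
    by rewrite uv; lra.
  have : 0 <= (1 - p) ^+ k by rewrite exprn_ge0// subr_ge0; case/andP: p01.
  move: kp; set K := k%:R * p; set e := (1 - p) ^+ k; nra.
- move=> H HP; rewrite -[leqRHS]muln1; apply: (dunion_card _ HP) => G.
  by move=> GP; have [h _ ->] := dmap_supp GP; rewrite cardfs1.
Qed.

(** * Lower bound *)

Section GroupPrivacy.
Variables (R : realType) (n m : nat) (Z O : choiceType) (eps : R).
Variable A : algorithm R n m Z O.
Hypothesis dpA : user_level_DP eps 0 A.

(** Differing users are replaced one at a time, each at the cost of a factor [expR eps]. *)
Lemma group_privacy (S : set O) (x y : dataset n m Z) :
  (pr (A x) S <= (expR (eps * #|[pred i | x i != y i]|%:R))%:E * pr (A y) S)%E.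
Proof.
move Ek : #|[pred i | x i != y i]| => k; elim: k x Ek => [|k IH] x Ek.
  have -> : x = y.
    apply/ffunP => i; apply/eqP; rewrite -[_ == _]negbK.
    by have := card0_eq Ek i; rewrite inE => ->.
  by rewrite mulr0 expR0 mul1e.
have /card_gt0P[i0] : (0 < #|[pred i | x i != y i]|)%N by rewrite Ek.
rewrite inE => xi0.
pose x' : dataset n m Z := [ffun i => if i == i0 then y i else x i].
have Ek' : #|[pred i | x' i != y i]| = k.
  move: Ek; rewrite (cardD1 i0) inE xi0 add1n => -[<-]; apply: eq_card => i.
  by rewrite !inE ffunE; case: (eqVneq i i0) => //=; rewrite eqxx.
have /dpA/(_ S) : user_neighbors x x'.
  by exists i0 => i /negPf ii; rewrite ffunE ii.
rewrite adde0 => /le_trans; apply.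
rewrite -natr1 mulrDr mulr1 addrC expRD EFinM -muleA.
by rewrite lee_wpmul2l ?lee_fin ?expR_ge0// IH.
Qed.

End GroupPrivacy.

(** From [expR (- t) >= 1 - t] one gets [expR t <= 1 / (1 - t)], at most [1 + 2 t] on this range. *)
Lemma expR_sub1_le (R : realType) (t : R) : 0 <= t <= 1 / 2 -> expR t - 1 <= 2 * t.
Proof.
case/andP=> t0 t1; have := expR_ge1Dx (- t); have := expRxMexpNx_1 t.
have := expR_gt0 t; set u := expR t; set v := expR (- t) => *; nra.
Qed.

Section LowerBound.
Variables (R : realType) (X : choiceType) (C : set (X -> bool)).
Variables (alpha eps : R) (n m : nat).
Variable A : algorithm R n m (X * bool)%type (X -> bool).
Hypothesis eps01 : 0 < eps <= 1 / 2.
Hypothesis dpA : user_level_DP eps 0 A.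
Hypothesis solA : forall D, valid (PAC C alpha) D ->
  ((2 / 3)%:E <= success_pr A D (correct (PAC C alpha) D))%E.

Definition cst_dataset (z : X * bool) : dataset n m (X * bool)%type :=
  [ffun=> [ffun=> z]].

Definition approx (c : X -> bool) (D : dist R X) : set (X -> bool) :=
  [set h | (pr D [set x | c x != h x] <= (1 / 4)%:E)%E].

(** The hard distribution: [r = 1] yields the bound on users, [r = 4 * alpha] the bound on
    samples. *)
Definition labelled_mix (r : R) (r01 : 0 <= r <= 1) (x0 : X) (c : X -> bool)
    (D : dist R X) : dist R (X * bool)%type :=
  dmap (fun x => (x, c x)) (dmix r01 (dret R x0) D).

(** [D] has weight [r] in the mixture, so error [alpha] there is error at most [alpha / r <= 1 / 4]
    under [D]. *)
Lemma labelled_mix_correct r (r01 : 0 <= r <= 1) x0 c D : 0 < r -> alpha <= r / 4 ->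
  correct (PAC C alpha) (labelled_mix r01 x0 c D) `<=` approx c D.
Proof.
move=> r0 ar h /=; rewrite /Err pr_dmap pr_dmix /approx /= => hE.
have -> : [set x | c x != h x] = [set x | h x != c x].
  by apply/seteqP; split=> x /=; rewrite eq_sym.
set S := [set x | _] in hE *.
have : (r%:E * pr D S <= alpha%:E)%E.
  apply: le_trans hE; rewrite leeDr// mule_ge0 ?pr_ge0// lee_fin.
  by case/andP: r01 => _; rewrite subr_ge0.
rewrite -(pr_fineK D S) -EFinM !lee_fin => /le_trans/(_ ar).
by rewrite mulrC -ler_pdivlMr// mulrAC divff ?gt_eqF.
Qed.

Lemma labelled_mix_valid r (r01 : 0 <= r <= 1) x0 c D : C c ->
  valid (PAC C alpha) (labelled_mix r01 x0 c D).
Proof.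
move=> Cc; exists c => //; rewrite /Err pr_dmap /pr esum1// => x /=.
by rewrite eqxx.
Qed.

(* Group privacy relates every sample to the constant dataset, at the cost of
   [exp eps] for each user that differs; only its expectation matters. *)
Lemma base_success (r : R) (r01 : 0 <= r <= 1) x0 c (D : dist R X)
    (F : dataset n m (X * bool)%type -> R) (a : R) :
  0 < r -> alpha <= r / 4 -> C c ->
  (forall x : dataset n m (X * bool)%type,
     expR (eps * #|[pred i | x i != cst_dataset (x0, c x0) i]|%:R) <= F x) ->
  (Ex (diid n (diid m (labelled_mix r01 x0 c D))) (fun x => (F x)%:E) <= (expR a)%:E)%E ->
  ((2 / 3 * expR (- a))%:E <= pr (A (cst_dataset (x0, c x0))) (approx c D))%E.
Proof.
move=> r0 ar Cc leF ExF.
have := solA (labelled_mix_valid r01 x0 D Cc); rewrite success_prE.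
set p := pr (A (cst_dataset _)) _.
have p0 : (0 <= p)%E by exact: pr_ge0.
have pE : p = (fine p)%:E by rewrite pr_fineK.
have fp0 : 0 <= fine p by rewrite fine_ge0.
move=> h; have {h} : ((2 / 3)%:E <= (fine p)%:E * (expR a)%:E)%E.
  apply: (le_trans h); apply: (@le_trans _ _ (Ex (diid n (diid m (labelled_mix r01 x0 c D)))
      (fun x => (fine p)%:E * (F x)%:E)%E)).
    apply: le_Ex => x; apply: le_trans (group_privacy dpA _ _ (cst_dataset (x0, c x0))) _.
    rewrite muleC lee_pmul ?pr_ge0 ?lee_fin ?expR_ge0//.
    rewrite -pE; apply: le_pr; exact: labelled_mix_correct.
  rewrite ExZl//; last by move=> x; rewrite lee_fin (le_trans (expR_ge0 _) (leF x)).
  by rewrite lee_wpmul2l.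
rewrite pE -EFinM !lee_fin => h.
by rewrite expRN ler_pdivrMr ?expR_gt0.
Qed.

Lemma base_success_users x0 c D : alpha <= 1 / 4 -> C c ->
  ((2 / 3 * expR (- (eps * n%:R)))%:E <=
   pr (A (cst_dataset (x0, c x0))) (approx c D))%E.
Proof.
move=> a4 Cc; have r01 : 0 <= (1 : R) <= 1 by rewrite ler01 lexx.
case/andP: eps01 => e0 _.
apply: (@base_success 1 r01 x0 c D (fun=> expR (eps * n%:R))) => //.
  move=> x; rewrite ler_expR ler_pM2l// ler_nat.
  by rewrite (leq_trans (max_card _))// card_ord.
by rewrite Ex_cst// expR_ge0.
Qed.

(** Charging [expR eps] to each differing example rather than to each differing user only increases
    the cost, and makes it a product over independent examples. One factor has mean at most [1 + 4
    alpha (expR eps - 1) <= expR (8 eps alpha)]. *)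
Lemma base_success_samples x0 c D : 0 < alpha <= 1 / 4 -> C c ->
  ((2 / 3 * expR (- (8 * eps * alpha * (n * m)%:R)))%:E <=
   pr (A (cst_dataset (x0, c x0))) (approx c D))%E.
Proof.
case/andP=> a0 a4 Cc; have r01 : 0 <= 4 * alpha <= 1 by apply/andP; split; lra.
case/andP: (eps01) => e0 e1.
pose f (z : X * bool) : R := if z == (x0, c x0) then 1 else expR eps.
have f1 z : 1 <= f z by rewrite /f; case: ifP => // _; rewrite -expR0 ler_expR ltW.
have f0 z : 0 <= f z by rewrite (le_trans _ (f1 z)).
pose e := expR (8 * eps * alpha).
have Exf : (Ex (labelled_mix r01 x0 c D) (fun z => (f z)%:E) <= e%:E)%E.
  have fE x : (0 <= (f (x, c x))%:E)%E by rewrite lee_fin.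
  rewrite Ex_dmap// (Ex_dmix _ _ _ fE) (Ex_dret _ fE).
  rewrite {1}/f eqxx mule1.
  apply: (@le_trans _ _ ((1 - 4 * alpha)%:E + (4 * alpha)%:E * (expR eps)%:E)%E).
    apply: leeD2l; apply: lee_wpmul2l; first by rewrite lee_fin; case/andP: r01.
    rewrite -[leRHS](Ex_cst D (expR_ge0 eps)); apply: le_Ex => x.
    by rewrite lee_fin /f; case: ifP => // _; rewrite -expR0 ler_expR ltW.
  rewrite -EFinM -EFinD lee_fin; apply: le_trans (expR_ge1Dx _).
  have : expR eps - 1 <= 2 * eps by apply: expR_sub1_le; rewrite ltW.
  nra.
apply: (@base_success (4 * alpha) r01 x0 c D
    (fun x => \prod_(i < n) \prod_(j < m) f (x i j))) => //.
- lra.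
- lra.
- move=> x; rewrite mulrC expRM_natl -prodr_const big_mkcond /=.
  apply: ler_prod => i _; rewrite inE; apply/andP; split.
    by case: ifP => // _; exact: expR_ge0.
  have prod1 (Q : pred 'I_m) : 1 <= \prod_(j < m | Q j) f (x i j).
    by apply: (big_ind (fun u => 1 <= u)) => // u v u1 v1; exact: mulr_ege1.
  case: ifP => [xi|_]; last exact: prod1.
  (* A differing user has a differing example, whose factor is [expR eps]; the other factors are at
     least 1. *)
  have [j xij] : exists j, x i j != (x0, c x0).
    apply/not_existsP => xi0; move/eqP: xi; apply; apply/ffunP => j.
    by rewrite !ffunE; have /negP := xi0 j; rewrite negbK => /eqP.
  rewrite (bigD1 j)//= {1}/f (negPf xij) ler_peMr ?expR_ge0//.
- rewrite [_ * (n * m)%:R]mulrC expRM_natl -/e.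
  have -> : e ^+ (n * m) = \prod_(i < n) \prod_(j < m) e.
    by rewrite !prodr_const !card_ord mulnC exprM.
  apply: (@Ex_diid_prod_le R {ffun 'I_m -> X * bool} n _
    (fun i u => \prod_(j < m) f (u j))) => [i u|i]; first by rewrite prodr_ge0.
  exact: (@Ex_diid_prod_le R _ m _ (fun=> f)).
Qed.

Lemma approx_dret c x : approx c (dret R x) `<=` [set h | h x = c x].
Proof.
move=> h; rewrite /approx /= pr_Ex Ex_dret; last by move=> t; rewrite lee_fin.
by rewrite indicE lee_fin; case: (h x =P c x) => // /eqP hc; rewrite mem_set/= 1?eq_sym//; lra.
Qed.

Lemma PRDim_le_privacy (d a : R) x0 x1 c1 c2 : is_PRDim C d -> 0 <= a ->
  C c1 -> C c2 -> c1 x0 = c2 x0 -> c1 x1 != c2 x1 ->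
  (forall c D, C c -> ((2 / 3 * expR (- a))%:E <=
     pr (A (cst_dataset (x0, c x0))) (approx c D))%E) ->
  d <= 49 * a.
Proof.
move=> dimC a0 C1 C2 c12 nc12 base.
(* Both concepts share the constant dataset at [x0], but their good answers for the point mass at
   [x1] are disjoint, so twice [2 / 3 * expR (- a)] is at most 1. *)
have ea : expR (- a) <= 3 / 4.
  have h1 := base c1 (dret R x1) C1; have h2 := base c2 (dret R x1) C2.
  rewrite -c12 in h2.
  have := @pr_disjoint_le1 R _ (A (cst_dataset (x0, c1 x0)))
    (approx c1 (dret R x1)) (approx c2 (dret R x1)).
  have -> : approx c1 (dret R x1) `&` approx c2 (dret R x1) = set0.
    rewrite -subset0 => h [/approx_dret /= e1 /approx_dret /= e2].
    by move/negP: nc12; apply; rewrite -e1 e2.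
  move=> /(_ erefl); move/(le_trans (leeD h1 h2)); rewrite -EFinD lee_fin; lra.
have a4 : 1 / 4 <= a.
  by have := expR_ge1Dx (- a); lra.
have r01 : 0 <= (1 / 2 : R) <= 1 by apply/andP; split; lra.
(* Mixing over both possible labels of [x0] makes [q] independent of [c] and lowers [2 / 3] to
   [1 / 3]. *)
pose q := dmix r01 (A (cst_dataset (x0, false))) (A (cst_dataset (x0, true))).
have : d <= a + ln 13.
  apply: (@PRDim_sample R X C d a q a0 dimC) => c Cc D.
  rewrite pr_dmix -/(approx c D).
  have := base c D Cc; have ge0 y := pr_ge0 (A (cst_dataset (x0, y))) (approx c D).
  have := ge0 false; have := ge0 true.
  have fK y := pr_fineK (A (cst_dataset (x0, y))) (approx c D).
  by case: (c x0); rewrite -(fK true) -(fK false) -!EFinM -EFinD !lee_fin; lra.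
(* Since [a >= 1 / 4], this constant is at most [48 * a], whence the factor 49. *)
have : ln (13 : R) <= 12.
  have -> : 13 = 1 + 12 :> R by lra.
  by apply: le_ln1Dx; lra.
lra.
Qed.

End LowerBound.

Lemma PRDim_gt0_pair (R : realType) (X : choiceType) (C : set (X -> bool)) (d : R) :
  is_PRDim C d -> 0 < d -> exists c1 c2, [/\ C c1, C c2 & c1 <> c2].
Proof.
move=> dimC d0; apply/not_existsP => h; move: d0; rewrite ltNge => /negP; apply.
have [[c0 C0]|nC] := pselect (exists c, C c); last first.
  apply: (@PRDim_subsingleton R X C d xpredT dimC) => c Cc.
  by case: nC; exists c.
apply: (@PRDim_subsingleton R X C d c0 dimC) => c Cc /=.
by apply: contrapT => ne; apply: (h c); exists c0.
Qed.

(** Otherwise any two distinct concepts would differ everywhere, so [C] would consist of one concept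
    and its complement. *)
Lemma noncomplementary_pair (R : realType) (X : choiceType) (C : set (X -> bool)) (d : R) :
  is_PRDim C d -> 0 < d -> ~ complementary_pair C ->
  exists c1 c2 x0 x1, [/\ C c1, C c2, c1 x0 = c2 x0 & c1 x1 != c2 x1].
Proof.
move=> dimC d0 ncp; apply: contrapT => nex.
have compl c1 c2 : C c1 -> C c2 -> c1 <> c2 -> c2 = (fun x => ~~ c1 x).
  move=> C1 C2 c12; apply/funext => x0; apply/eqP/negPn/negP => e0.
  apply: c12; apply/funext => x1; apply/eqP/negPn/negP => e1; apply: nex.
  by exists c1, c2, x0, x1; split=> //; move: e0; case: (c1 x0); case: (c2 x0).
have [c1 [c2 [C1 C2 c12]]] := PRDim_gt0_pair dimC d0.
apply: ncp; exists c1; apply/seteqP; split=> [c Cc|c [->//|->]].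
  by have [->|ne] := pselect (c = c1); [left|right; apply: compl => // /esym].
by rewrite -(compl c1 c2).
Qed.

Lemma lower_bound (R : realType) (X : choiceType) (C : set (X -> bool))
    (d alpha eps : R) (n m : nat) :
  is_PRDim C d -> 0 < d -> ~ complementary_pair C ->
  0 < alpha <= 1 / 4 -> 0 < eps <= 1 / 2 -> (0 < m)%N ->
  solvable (PAC C alpha) m eps 0 n ->
  d / eps + d / (eps * alpha * m%:R) <= 441 * n%:R.
Proof.
move=> dimC d0 ncp a01 e01 m0 [A [dpA solA]].
have [c1 [c2 [x0 [x1 [C1 C2 c12 nc12]]]]] := noncomplementary_pair dimC d0 ncp.
case/andP: (a01) => a0 a4; case/andP: (e01) => e0 e2.
have m0' : 0 < m%:R :> R by rewrite ltr0n.
have n0 : 0 <= n%:R :> R by [].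
have h1 : d <= 49 * (eps * n%:R).
  apply: (PRDim_le_privacy dimC _ C1 C2 c12 nc12 (A := A)) => [|c D Cc].
    by rewrite mulr_ge0// ltW.
  exact: (base_success_users e01 dpA solA).
have h2 : d <= 49 * (8 * eps * alpha * (n * m)%:R).
  apply: (PRDim_le_privacy dimC _ C1 C2 c12 nc12 (A := A)) => [|c D Cc].
    by rewrite !mulr_ge0// ltW.
  exact: (base_success_samples e01 dpA solA).
(* The share [392 = 49 * 8] goes to the term with [alpha]. *)
have -> : 441 * n%:R = 49 * n%:R + 392 * n%:R :> R by lra.
apply: lerD; rewrite ler_pdivrMr ?mulr_gt0//; first by lra.
by rewrite natrM in h2; lra.
Qed.

(** * Boosting a representation *)

Section FsetImages.
Variables (K L : choiceType).

Definition cons_fset (H : {fset K}) (S : {fset (seq K)}) : {fset (seq K)} :=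
  seq_fset tt [seq h :: s | h <- H, s <- S].

Lemma mem_cons_fset H S h s : h \in H -> s \in S -> h :: s \in cons_fset H S.
Proof. by move=> hH sS; rewrite seq_fsetE; apply/allpairsP; exists (h, s). Qed.

Lemma card_cons_fset H S : (#|` cons_fset H S| <= #|` H| * #|` S|)%N.
Proof. by rewrite size_seq_fset (leq_trans (size_undup _))// size_allpairs. Qed.

Definition map_fset (f : K -> L) (S : {fset K}) : {fset L} :=
  seq_fset tt [seq f s | s <- S].

Lemma mem_map_fset f S s : s \in S -> f s \in map_fset f S.
Proof. by move=> sS; rewrite seq_fsetE map_f. Qed.

Lemma card_map_fset f S : (#|` map_fset f S| <= #|` S|)%N.
Proof. by rewrite size_seq_fset (leq_trans (size_undup _))// size_map. Qed.

End FsetImages.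

Section Reweight.
Variables (R : realType) (T : choiceType) (p : dist R T) (g : T -> R) (z : R).
Hypotheses (g0 : forall t, 0 <= g t) (z0 : 0 < z) (pg : Ex p (fun t => (g t)%:E) = z%:E).

Lemma reweight_ge0 t : 0 <= z^-1 * (p t * g t).
Proof. by rewrite !mulr_ge0 ?mass_ge0// invr_ge0 ltW. Qed.

Lemma esum_reweight f : (forall t, 0 <= f t)%E ->
  (\esum_(t in [set: T]) ((z^-1 * (p t * g t))%:E * f t) =
   z^-1%:E * Ex p (fun t => (g t)%:E * f t))%E.
Proof.
move=> f0; rewrite -esumZl; first by apply: eq_esum => t _; rewrite !EFinM !muleA.
  by rewrite invr_ge0 ltW.
by move=> t; rewrite !mule_ge0 ?lee_fin ?mass_ge0.
Qed.

Lemma reweight_sum1 : (\esum_(t in [set: T]) (z^-1 * (p t * g t))%:E = 1)%E.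
Proof.
under eq_esum do rewrite -[X in X%:E]mulr1 EFinM.
rewrite esum_reweight//; under eq_Ex do rewrite mule1.
by rewrite pg -EFinM mulVf ?gt_eqF.
Qed.

(** The law with density [g / z] with respect to [p]; in boosting, [g] is the loss of one
    hypothesis. *)
Definition reweight : dist R T := Dist reweight_ge0 reweight_sum1.

Lemma Ex_reweight f : (forall t, 0 <= f t)%E ->
  (Ex p (fun t => (g t)%:E * f t) = z%:E * Ex reweight f)%E.
Proof.
move=> f0; rewrite [X in (_ * X)%E]esum_reweight// muleA -EFinM divff ?mul1e//.
by rewrite gt_eqF.
Qed.

End Reweight.

Section Boosting.
Variables (R : realType) (X : choiceType) (c : X -> bool).
Implicit Types (D : dist R X) (P : dist R {fset (X -> bool)}) (h : X -> bool) (s : seq (X -> bool)).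

(* Multiplicative weights with factor 3 on mistakes: a weak hypothesis of error at
   most 1/4 increases the total weight by a factor at most 3/2, whereas a point
   misclassified by a majority vote has its weight multiplied by [sqrt 3] per round. *)
Definition loss h x : R := if h x != c x then 3 else 1.

Definition losses s x : R := \prod_(h <- s) loss h x.

Definition maj s x : bool := (size s < 2 * count (fun h => h x) s)%N.

Lemma loss_gt0 h x : 0 < loss h x.
Proof. by rewrite /loss; case: ifP. Qed.

Lemma losses_gt0 s x : 0 < losses s x.
Proof. by apply: prodr_gt0 => h _; exact: loss_gt0. Qed.

Lemma lossesE s x : losses s x = 3 ^+ count (fun h => h x != c x) s.
Proof.
elim: s => [|h s IH]; first by rewrite /losses big_nil.
rewrite /losses big_cons -/(losses s x) IH /loss /=.
by case: ifP => _; rewrite ?mul1r// exprS.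
Qed.

(** Ties vote [false], so a wrong vote guarantees only half of the hypotheses to be wrong, not a
    strict majority. *)
Lemma maj_wrong s x : maj s x != c x -> (size s <= 2 * count (fun h => h x != c x) s)%N.
Proof.
rewrite /maj; case: (c x); last first.
  rewrite eqbF_neg negbK => /ltnW/leq_trans; apply; rewrite leq_mul2l/=.
  by rewrite (@eq_count _ (fun h => h x != false) (fun h => h x))// => h /=; case: (h x).
rewrite eqb_id -leqNgt => le.
have := count_predC (fun h : X -> bool => h x) s.
rewrite (@eq_count _ (predC (fun h : X -> bool => h x)) (fun h => h x != true)); last first.
  by move=> h /=; case: (h x).
move=> e; rewrite -(leq_add2l (2 * count (fun h => h x) s)) -mulnDr e [(2 * size s)%N]mul2n -addnn.
by rewrite leq_add2r.
Qed.

Definition boosted (t : nat) D : set (seq (X -> bool)) :=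
  [set s | size s = t /\ (Ex D (fun x => (losses s x)%:E) <= ((3 / 2) ^+ t)%:E)%E].

(** Markov's inequality: a misclassified point has weight at least [3 ^+ k], while the total weight
    is at most [(9 / 4) ^+ k]. *)
Lemma boosted_maj k D s : boosted (2 * k) D s ->
  (pr D [set x | c x != maj s x] <= ((3 / 4) ^+ k)%:E)%E.
Proof.
move=> [size_s le]; set S := [set x | _].
have : ((3 ^+ k)%:E * pr D S <= ((3 / 2) ^+ (2 * k))%:E)%E.
  rewrite pr_Ex -ExZl ?exprn_ge0//.
  apply: le_trans le; apply: le_Ex => x; rewrite -EFinM lee_fin indicE.
  case: (boolP (x \in S)) => [/set_mem /= Sx|_]; last by rewrite mulr0 ltW// losses_gt0.
  rewrite mulr1 lossesE ler_eXn2l// ?ltr1n//.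
  by rewrite -(leq_pmul2l (ltn0Sn 1)) -size_s maj_wrong// eq_sym.
rewrite -(pr_fineK D S) -EFinM !lee_fin mulrC -ler_pdivlMr ?exprn_gt0// => /le_trans; apply.
by rewrite exprM -expr_div_n lerXn2r ?nnegrE//; lra.
Qed.

(** The good hypothesis of each round depends on the unknown [c] and [D], so all sequences with one
    member from each of [t] independent draws are kept. *)
Fixpoint dboost t P : dist R {fset (seq (X -> bool))} :=
  if t is t1.+1 then
    dbind P (fun H => dmap (cons_fset H) (dboost t1 P))
  else dret R [fset [::]]%fset.

Lemma dboost_card t P M : (forall H, P H != 0 -> (#|` H| <= M)%N) ->
  forall S, dboost t P S != 0 -> (#|` S| <= M ^ t)%N.
Proof.
move=> PM; elim: t => [|t IH] S; rewrite [dboost _ _]/=.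
  by move=> /dret_supp ->; rewrite cardfs1.
move=> h; have [H [PH h2]] := dbind_supp h; have [G GM ->] := dmap_supp h2.
by rewrite (leq_trans (card_cons_fset _ _))// expnS leq_mul ?PM ?IH.
Qed.

Lemma Ex_loss h D : (pr D [set x | c x != h x] <= (1 / 4)%:E)%E ->
  exists z, [/\ 0 < z, z <= 3 / 2 & Ex D (fun x => (loss h x)%:E) = z%:E].
Proof.
set S := [set x | _] => hS.
have -> : Ex D (fun x => (loss h x)%:E) = (1 + 2 * fine (pr D S))%:E.
  rewrite EFinD EFinM pr_fineK pr_Ex -ExZl//.
  rewrite -(Ex_cst D ler01) -ExD//.
  apply: eq_Ex => x; rewrite -EFinM -EFinD indicE /loss; congr EFin.
  have -> : (x \in S) = (h x != c x) by apply/idP/idP; rewrite inE /S/= eq_sym.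
  by case: (h x != c x) => /=; lra.
exists (1 + 2 * fine (pr D S)); have := pr_ge0 D S.
by rewrite -(pr_fineK D S) lee_fin in hS *; rewrite lee_fin => p0; split=> //; lra.
Qed.

(** A union bound over the rounds, each of which fails with probability at most [b]. *)
Lemma dboost_miss t P (b : R) : 0 <= b ->
  (forall D, (pr P (~` hit [set h | (pr D [set x | c x != h x] <= (1 / 4)%:E)%E]) <= b%:E)%E) ->
  forall D, (pr (dboost t P) (~` hit (boosted t D)) <= (t%:R * b)%:E)%E.
Proof.
move=> b0 Pb; elim: t => [|t IH] D; rewrite [dboost _ _]/=.
  rewrite mul0r pr_Ex Ex_dret; last by move=> t; rewrite lee_fin.
  rewrite indicE memNset//=; apply; exists [::]; first by rewrite in_fset1.
  split=> //; rewrite expr0 -[leRHS](Ex_cst D ler01); apply: le_Ex => x.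
  by rewrite /losses big_nil.
rewrite pr_dbind; under eq_Ex do rewrite pr_dmap.
have := Pb D; set B := [set h | _] => PbD.
apply: (@le_trans _ _ (Ex P (fun H => (\1_(~` hit B) H)%:E + (t%:R * b)%:E))%E).
  apply: le_Ex => H; rewrite indicE; case: (boolP (H \in ~` hit B)) => [_|].
    apply: (le_trans (pr_le1 _ _)).
    by rewrite -EFinD lee_fin lerDl mulr_ge0.
  rewrite in_setC negbK add0e => /set_mem[h hH Bh].
  have [z [z0 z32 Ez]] := Ex_loss Bh.
  (* A good [h] in the first draw fixes the law [D'] for the next rounds; the remaining draws are
     independent of it, so induction applies to [D']. *)
  pose D' := reweight (fun x => ltW (loss_gt0 h x)) z0 Ez.
  apply: le_trans (IH D'); apply: le_pr => S nS [s sS [size_s les]].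
  apply: nS; exists (h :: s); first exact: mem_cons_fset.
  split; first by rewrite /= size_s.
  under eq_Ex do rewrite /losses big_cons EFinM -/(losses s _).
  rewrite (Ex_reweight (fun x => ltW (loss_gt0 h x)) z0 Ez); last first.
    by move=> x; rewrite lee_fin ltW// losses_gt0.
  rewrite exprS EFinM; apply: lee_pmul => //.
  - by rewrite lee_fin ltW.
  - by apply: Ex_ge0 => x; rewrite lee_fin ltW// losses_gt0.
rewrite ExD//; last by move=> H; rewrite lee_fin mulr_ge0.
rewrite Ex_cst ?mulr_ge0// -pr_Ex -natr1 mulrDl mul1r EFinD addeC.
exact: leeD2r.
Qed.

End Boosting.

Lemma boosted_representation (R : realType) (X : choiceType) (C : set (X -> bool))
    (P : dist R {fset (X -> bool)}) (N k : nat) : (0 < k)%N ->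
  prob_representation (1 / 4) (1 / 4) C P ->
  (forall H, P H != 0 -> (#|` H| <= N)%N) ->
  exists Q : dist R {fset (X -> bool)},
    prob_representation ((3 / 4) ^+ k) (1 / 8) C Q /\
    (forall H, Q H != 0 -> (#|` H| <= (2 * k * N) ^ (2 * k))%N).
Proof.
move=> k0 Prep PN; set t := (2 * k)%N.
(* [t] serves twice: as the number of rounds and as the number of copies of [P] per round. A round
   then fails with probability at most [(1 / 4) ^+ t], and [t] rounds with at most [1 / 8]. *)
exists (dmap (map_fset (@maj X)) (dboost t (dunion t P))); split; last first.
  move=> H HQ; have [S S0 ->] := dmap_supp HQ.
  apply: leq_trans (card_map_fset _ _) _.
  by apply: (dboost_card _ S0) => G; exact: dunion_card.
move=> c Cc D; rewrite hitE pr_setC_le.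
have b0 : 0 <= (1 / 4 : R) ^+ t by rewrite exprn_ge0.
have Pb (D' : dist R X) : (pr (dunion t P)
    (~` hit [set h | (pr D' [set x | c x != h x] <= (1 / 4)%:E)%E]) <= ((1 / 4) ^+ t)%:E)%E.
  apply: dunion_miss; first by rewrite divr_ge0.
  by rewrite -pr_setC_le; exact: (Prep c Cc D').
apply: (@le_trans _ _ (t%:R * (1 / 4) ^+ t)%:E); last first.
  (* Equality holds at [t = 2], the smallest case because [k > 0]. *)
  have t8 : (8 * t <= 4 ^ t)%N.
    rewrite /t; case: k k0 {t Pb b0} => // k _; elim: k => // k IH.
    rewrite (_ : (2 * k.+2 = 2 * k.+1 + 2)%N); last by rewrite -[k.+2]addn1 mulnDr.
    rewrite expnD mulnDr (leq_trans (leq_add IH (leqnn _)))//.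
    have Y16 : (8 * 2 <= 4 ^ (2 * k.+1))%N by rewrite (leq_trans _ IH)// leq_mul2l leq_pmulr.
    move: Y16; set Y := (4 ^ (2 * k.+1))%N => Y16.
    by rewrite [(Y * 4 ^ 2)%N](mulnS Y 15) leq_add2l (leq_trans Y16)// leq_pmulr.
  have t8R : 8 * t%:R <= 4 ^+ t :> R by rewrite -natrX -natrM ler_nat.
  have p4 : 0 < 4 ^+ t :> R by rewrite exprn_gt0.
  rewrite lee_fin expr_div_n expr1n mulrA mulr1 ler_pdivrMr//; lra.
apply: le_trans (dboost_miss t b0 Pb D); rewrite pr_dmap; apply: le_pr => S nS [s sS bs].
by apply: nS; exists (maj s); [exact: mem_map_fset|exact: boosted_maj].
Qed.

(** * Exponential mechanism *)

Section FiniteDist.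
Variables (R : realType) (O : choiceType) (G : {fset O}) (w : O -> R).
Hypotheses (w0 : forall h, 0 < w h) (Gne : (0 < #|` G|)%N).

Let Z := \sum_(h <- G) w h.

Lemma le_weight_total g : g \in G -> w g <= Z.
Proof.
by move=> gG; rewrite /Z (big_fsetD1 g)//= lerDl sumr_ge0// => h _; rewrite ltW.
Qed.

Lemma total_weight_gt0 : 0 < Z.
Proof.
have /fset0Pn[g gG] : G != fset0 by rewrite -cardfs_gt0.
exact: lt_le_trans (w0 g) (le_weight_total gG).
Qed.

Lemma dfin_ge0 h : 0 <= (if h \in G then w h / Z else 0).
Proof. by case: ifP => // _; rewrite divr_ge0// ltW// total_weight_gt0. Qed.

Lemma esum_dfin f : (forall h, 0 <= f h)%E ->
  (\esum_(h in [set: O]) ((if h \in G then w h / Z else 0)%:E * f h) =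
   \sum_(h <- G) (w h / Z)%:E * f h)%E.
Proof.
move=> f0; transitivity (\esum_(h in [set` G]) ((w h / Z)%:E * f h))%E.
  rewrite [RHS]esum_mkcond; apply: eq_esum => h _.
  rewrite (_ : (h \in [set` G]) = (h \in G)); first by case: ifP; rewrite ?mul0e.
  by apply/idP/idP; rewrite inE.
rewrite esum_fset//; last first.
  by move=> h _; rewrite mule_ge0// lee_fin divr_ge0// ltW// total_weight_gt0.
by rewrite fsbig_finite//= set_fsetK.
Qed.

Lemma dfin_sum1 : (\esum_(h in [set: O]) (if h \in G then w h / Z else 0)%:E = 1)%E.
Proof.
under eq_esum do rewrite -[X in X%:E]mulr1 EFinM.
rewrite esum_dfin//; under eq_bigr do rewrite -EFinM mulr1.
by rewrite sumEFin -mulr_suml divff// gt_eqF// total_weight_gt0.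
Qed.

Definition dfin : dist R O := Dist dfin_ge0 dfin_sum1.

Lemma pr_dfin S : pr dfin S = (\sum_(h <- G) (w h / Z * \1_S h)%:E)%E.
Proof. by rewrite pr_Ex [LHS]esum_dfin// => h; rewrite lee_fin. Qed.

End FiniteDist.

Arguments dfin : simpl never.

(** Numerator and normalizing sum each change by a factor at most [expR t]. *)
Lemma pr_dfin_le (R : realType) (O : choiceType) (G : {fset O}) (w w' : O -> R)
    (w0 : forall h, 0 < w h) (w0' : forall h, 0 < w' h) (Gne : (0 < #|` G|)%N)
    (t : R) S :
  (forall h, w h <= expR t * w' h) -> (forall h, w' h <= expR t * w h) ->
  (pr (dfin w0 Gne) S <= (expR (2 * t))%:E * pr (dfin w0' Gne) S)%E.
Proof.
move=> ww' w'w; rewrite !pr_dfin ge0_sume_distrr; last first.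
  move=> h _; rewrite lee_fin !mulr_ge0// ?invr_ge0 ltW//; exact: total_weight_gt0.
apply: lee_sum => h _; rewrite -EFinM lee_fin mulrA ler_wpM2r//.
have Z0 := total_weight_gt0 w0 Gne; have Z0' := total_weight_gt0 w0' Gne.
rewrite ler_pdivrMr// mulrA mulrAC ler_pdivlMr//.
have ZZ : \sum_(h <- G) w' h <= expR t * \sum_(h <- G) w h.
  by rewrite mulr_sumr; apply: ler_sum => g _.
have -> : expR (2 * t) = expR t * expR t by rewrite -expRD; congr expR; lra.
by rewrite -[leRHS]mulrA mulrACA; apply: ler_pM => //; rewrite ltW.
Qed.

Section ExpMech.
Variables (R : realType) (X : choiceType) (n m q : nat) (t : R).
Hypotheses (t01 : 0 < t <= 1 / 2) (qm : (q <= m)%N).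
Implicit Types (h : X -> bool) (u : {ffun 'I_m -> X * bool}).
Implicit Types (x : dataset n m (X * bool)%type).

(** Only [q] examples are inspected: with [q] later at most of order [1 / alpha], an accurate
    hypothesis stays consistent with most users. *)
Definition consistent h u : bool :=
  [forall j : 'I_m, (j < q)%N ==> (h (u j).1 == (u j).2)].

Definition user_weight h u : R := if consistent h u then 1 else expR (- t).

(** The weight of the exponential mechanism whose score counts inconsistent users; one user changes
    the score by at most 1. *)
Definition weight x h : R := \prod_(i < n) user_weight h (x i).

Let t0 : 0 < t. Proof. by case/andP: t01. Qed.

Lemma expRN_lt1 : expR (- t) < 1.
Proof. by rewrite expR_lt1 oppr_lt0. Qed.

Lemma user_weight_gt0 h u : 0 < user_weight h u.
Proof. by rewrite /user_weight; case: ifP => // _; exact: expR_gt0. Qed.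

Lemma weight_gt0 x h : 0 < weight x h.
Proof. by apply: prodr_gt0 => i _; exact: user_weight_gt0. Qed.

Lemma weight_neighbors x x' h : user_neighbors x x' ->
  weight x h <= expR t * weight x' h.
Proof.
move=> [i xx']; rewrite /weight (bigD1 i)//= [in leRHS](bigD1 i)//= mulrA.
rewrite (eq_bigr (fun k => user_weight h (x' k))); last by move=> k /xx' ->.
apply: ler_wpM2r; first by apply: prodr_ge0 => k _; rewrite ltW// user_weight_gt0.
apply: (@le_trans _ _ 1).
  by rewrite /user_weight; case: ifP => // _; rewrite ltW// expRN_lt1.
rewrite /user_weight; case: ifP => _; last by rewrite expRxMexpNx_1.
by rewrite mulr1 -expR0 ler_expR ltW.
Qed.

Definition expmech (G : {fset (X -> bool)}) (Gne : (0 < #|` G|)%N)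
  : algorithm R n m (X * bool)%type (X -> bool) :=
  fun x => dfin (weight_gt0 x) Gne.

Lemma expmech_DP G Gne : user_level_DP (2 * t) 0 (@expmech G Gne).
Proof.
move=> x x' xx' S; rewrite adde0; apply: pr_dfin_le => h; apply: weight_neighbors => //.
by case: xx' => i xx'; exists i => k /xx'.
Qed.

Section Utility.
Variable D : dist R (X * bool)%type.

Let err h : R := fine (Err D h).

Lemma Ex_consistent h :
  Ex (diid m D) (fun u => ((consistent h u)%:R)%:E) = ((1 - err h) ^+ q)%:E.
Proof.
pose f (j : 'I_m) (z : X * bool) : R := if (j < q)%N then (h z.1 == z.2)%:R else 1.
pose e (j : 'I_m) : R := if (j < q)%N then 1 - err h else 1.
have -> : (1 - err h) ^+ q = \prod_(j < m) e j.
  by rewrite -big_mkcond /= big_ord_narrow// prodr_const card_ord.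
rewrite -(@Ex_diid_prod R _ m D f e).
- apply: eq_Ex => u; congr EFin.
  case: (boolP (consistent h u)) => [/forallP cu|].
    rewrite big1// => j _; rewrite /f; case: ifP => // jq.
    by have := cu j; rewrite jq /= => ->.
  rewrite negb_forall => /existsP[j]; rewrite negb_imply => /andP[jq hj].
  by rewrite (bigD1 j)//= /f jq (negPf hj) mul0r.
- by move=> j z; rewrite /f; case: ifP.
- move=> j; rewrite /f /e; case: ifP => _; last by rewrite Ex_cst.
  have -> : 1 - err h = fine (pr D (~` [set z | h z.1 != z.2])).
    have := pr_setC D [set z | h z.1 != z.2].
    by rewrite -(pr_fineK D (~` _)) -(pr_fineK D [set z | _]) -EFinD => -[]; rewrite /err /Err; lra.
  rewrite pr_fineK pr_Ex; apply: eq_Ex => z.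
  congr EFin; rewrite indicE in_setC.
  have -> : (z \in [set z | h z.1 != z.2]) = (h z.1 != z.2) by apply/idP/idP; rewrite inE.
  by rewrite negbK.
Qed.

(** Write [v = q alpha], [a = 1 - expR (- t) >= t / 2] and [b = expR t - 1 <= 2 t]. The mean is at
    most [1 - a v / 3 + b v / 24 <= 1 - t v / 12]; the accuracy gap 24 makes the gain twice the
    loss. *)
Lemma Ex_user_ratio (alpha : R) h h1 : 0 < alpha -> q%:R * alpha <= 2 ->
  alpha <= err h -> err h1 <= alpha / 24 ->
  (Ex (diid m D) (fun u => (user_weight h u / user_weight h1 u)%:E) <=
   (expR (- (t * (q%:R * alpha) / 12)))%:E)%E.
Proof.
move=> a0 qa herr h1err.
set a := 1 - expR (- t); set b := expR t - 1.
have a_pos : 0 <= a by rewrite subr_ge0 ltW// expRN_lt1.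
have a_le1 : 0 <= 1 - a by rewrite /a opprB addrC subrK expR_ge0.
have b_pos : 0 <= b by rewrite subr_ge0 -expR0 ler_expR ltW.
have b2t : b <= 2 * t by apply: expR_sub1_le; case/andP: t01 => /ltW -> ->.
have ab : expR t * expR (- t) = 1 by exact: expRxMexpNx_1.
have eN0 := expR_gt0 (- t).
have at2 : t / 2 <= a.
  have := expR_ge1Dx t; move: ab eN0 t01; rewrite /a.
  set E := expR t; set F := expR (- t) => ab eN0 /andP[_ t2] Et; nra.
(* Serves the case of two inconsistent hypotheses, where the ratio 1 is compared with
   [1 - a + b]. *)
have le_ab : a <= b.
  move: ab eN0; rewrite /a /b; set E := expR t; set F := expR (- t) => ab F0.
  have : 0 <= (E - F) ^+ 2 by rewrite sqr_ge0.
  have E1 : 1 <= E by move: b_pos; rewrite /b -/E; lra.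
  nra.
pose cG h u : R := (consistent h u)%:R.
apply: (@le_trans _ _ (Ex (diid m D)
  (fun u => (1 - a)%:E + (a%:E * (cG h u)%:E + b%:E * (1 - cG h1 u)%:E))%E)).
  apply: le_Ex => u; rewrite -!EFinM -!EFinD lee_fin /cG /user_weight.
  case: (consistent h u); case: (consistent h1 u); rewrite /= ?divr1 ?mul1r.
  - lra.
  - by rewrite expRN invrK /b; lra.
  - by rewrite /a; lra.
  - by rewrite divff ?gt_eqF//; lra.
have cG01 g u : 0 <= cG g u <= 1 by rewrite /cG ler0n lern1 leq_b1.
have p0 g u : (0 <= (cG g u)%:E)%E by rewrite lee_fin; case/andP: (cG01 g u).
have p1 u : (0 <= a%:E * (cG h u)%:E)%E.
  by rewrite -EFinM lee_fin mulr_ge0//; case/andP: (cG01 h u).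
have p2 u : (0 <= (1 - cG h1 u)%:E)%E.
  by rewrite lee_fin subr_ge0; case/andP: (cG01 h1 u).
have p3 u : (0 <= b%:E * (1 - cG h1 u)%:E)%E by rewrite mule_ge0.
have p4 u : (0 <= a%:E * (cG h u)%:E + b%:E * (1 - cG h1 u)%:E)%E by rewrite adde_ge0.
rewrite (@ExD _ _ _ (fun=> (1 - a)%:E) _ _ p4)// Ex_cst//.
rewrite (ExD _ p1 p3) (ExZl _ b_pos p2) (ExZl _ a_pos (p0 h)).
rewrite (Ex_consistent h : Ex (diid m D) (fun u => (cG h u)%:E) = _).
have -> : Ex (diid m D) (fun u => (1 - cG h1 u)%:E) = (1 - (1 - err h1) ^+ q)%:E.
  have : (Ex (diid m D) (fun u => (cG h1 u)%:E) +
          Ex (diid m D) (fun u => (1 - cG h1 u)%:E) = 1)%E.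
    rewrite -(ExD _ (p0 h1) p2) -[RHS](Ex_cst (diid m D) ler01).
    by apply: eq_Ex => u; rewrite -EFinD; congr EFin; lra.
  rewrite (Ex_consistent h1 : Ex (diid m D) (fun u => (cG h1 u)%:E) = _).
  by case: (Ex _ _) => // r; rewrite -EFinD => -[] e; congr EFin; lra.
rewrite -!EFinM -!EFinD lee_fin; apply: le_trans (expR_ge1Dx _).
have err01 g : 0 <= err g <= 1.
  by rewrite -!lee_fin /err pr_fineK pr_ge0 pr_le1.
(* For [v = q alpha], [bernoulli_inv] gives [1 / (1 + v)], at most [1 - v / 3] because
   [0 <= v <= 2]. *)
have Y1 : (1 - err h) ^+ q <= 1 - q%:R * alpha / 3.
  have a1 : 0 <= alpha <= 1 by rewrite ltW//=; case/andP: (err01 h) => _; exact: le_trans.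
  apply: (@le_trans _ _ ((1 - alpha) ^+ q)).
    by rewrite lerXn2r ?nnegrE//; [case/andP: (err01 h); lra|case/andP: a1; lra|lra].
  have := bernoulli_inv q a1; set y := (1 - alpha) ^+ q.
  have y0 : 0 <= y by rewrite exprn_ge0// subr_ge0; case/andP: a1.
  have : 0 <= q%:R * alpha by rewrite mulr_ge0// ltW.
  move: qa; set v := q%:R * alpha => *; nra.
have Y2 : 1 - (1 - err h1) ^+ q <= q%:R * alpha / 24.
  have : 1 - q%:R * err h1 <= (1 - err h1) ^+ q.
    case/andP: (err01 h1) => e0 e1; elim: (q) => [|k IH]; first by rewrite expr0 mul0r subr0.
    rewrite exprS -natr1; have k0 : 0 <= k%:R :> R by [].
    move: IH k0; set K := k%:R; set y := _ ^+ k; set e := err h1 in e0 e1 * => *; nra.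
  have : q%:R * err h1 <= q%:R * (alpha / 24) by rewrite ler_wpM2l.
  lra.
move: Y1 Y2; set y1 := (1 - err h) ^+ q; set y2 := 1 - (1 - err h1) ^+ q.
have v0 : 0 <= q%:R * alpha by rewrite mulr_ge0// ltW.
move: v0; set v := q%:R * alpha => v0 Y1 Y2.
have s1 : a * y1 <= a * (1 - v / 3) by rewrite ler_wpM2l.
have s2 : b * y2 <= b * (v / 24) by rewrite ler_wpM2l.
have s3 : b * (v / 24) <= 2 * t * (v / 24) by rewrite ler_wpM2r// divr_ge0.
have s4 : t / 2 * (v / 3) <= a * (v / 3) by rewrite ler_wpM2r// divr_ge0.
lra.
Qed.

(** Bounding the normalizing sum below by the single term of [h1] leaves one ratio of weights per
    bad [h], and its moment factors over users. *)
Lemma expmech_failure (alpha : R) G Gne h1 : 0 < alpha -> q%:R * alpha <= 2 ->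
  h1 \in G -> err h1 <= alpha / 24 ->
  (Ex (diid n (diid m D)) (fun x => pr (@expmech G Gne x) [set h | (alpha%:E < Err D h)%E]) <=
   (#|` G|%:R * expR (- (n%:R * (t * (q%:R * alpha) / 12))))%:E)%E.
Proof.
move=> a0 qa h1G h1err; set S := [set h | _].
apply: (@le_trans _ _ (Ex (diid n (diid m D)) (fun x : dataset n m (X * bool)%type =>
    \sum_(h <- G) (\1_S h)%:E * (weight x h / weight x h1)%:E)%E)).
  apply: le_Ex => x; rewrite pr_dfin; apply: lee_sum => h _.
  rewrite -EFinM lee_fin mulrC ler_wpM2l// ler_wpM2l ?(ltW (weight_gt0 _ _))//.
  rewrite lef_pV2 ?posrE ?weight_gt0//; first exact: (le_weight_total (weight_gt0 x)).
  exact: (total_weight_gt0 (weight_gt0 x)).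
have w0 h x : (0 <= (weight x h / weight x h1)%:E)%E.
  by rewrite lee_fin divr_ge0// ltW// weight_gt0.
rewrite Ex_sum; last by move=> h x; rewrite mule_ge0// lee_fin.
set E := expR _; apply: (@le_trans _ _ (\sum_(h <- G) E%:E)%E); last first.
  by rewrite sumEFin lee_fin big_const_seq count_predT iter_addr_0 mulr_natl.
apply: lee_sum => h _; rewrite ExZl// indicE.
case: (boolP (h \in S)) => [/set_mem /= Sh|_]; last by rewrite mul0e lee_fin expR_ge0.
rewrite mul1e.
under eq_Ex => x do rewrite /weight -prodf_div.
have -> : E = \prod_(i < n) expR (- (t * (q%:R * alpha) / 12)).
  by rewrite prodr_const card_ord -expRM_natl /E mulrN.
apply: (@Ex_diid_prod_le R _ n (diid m D) (fun i u => user_weight h u / user_weight h1 u)).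
  by move=> i u; rewrite divr_ge0// ltW// user_weight_gt0.
move=> i; apply: Ex_user_ratio => //.
by rewrite -lee_fin /err pr_fineK ltW.
Qed.

End Utility.
End ExpMech.

(** * Upper bound *)

Lemma cardfs1U_gt0 (K : choiceType) (a : K) (H : {fset K}) : (0 < #|` (a |` H)%fset|)%N.
Proof. by rewrite cardfs_gt0; apply/fset0Pn; exists a; rewrite in_fset1U eqxx. Qed.

Lemma Err_le_marginal (R : realType) (X : choiceType) (D : dist R (X * bool)%type) c h :
  Err D c = 0%E -> (Err D h <= pr (dmap fst D) [set x | c x != h x])%E.
Proof.
move=> Dc; rewrite pr_dmap -[leRHS]adde0 -Dc.
apply: le_trans (pr_setU_le _ _ _); apply: le_pr => z /=.
by case: (h z.1); case: (c z.1); case: (z.2) => //=; [right|left|left|right].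
Qed.

(** [H] is drawn independently of the data, so averaging over it preserves privacy. The draw of [H]
    and the mechanism each succeed with probability at least [7 / 8], and [49 / 64 >= 2 / 3].
    Adjoining [h0] keeps the set nonempty, whence [M.+1]. *)
Lemma representation_solvable (R : realType) (X : choiceType) (C : set (X -> bool))
    (Q : dist R {fset (X -> bool)}) (M n m q : nat) (alpha t : R) :
  0 < t <= 1 / 2 -> 0 < alpha -> (q <= m)%N -> q%:R * alpha <= 2 ->
  prob_representation (alpha / 24) (1 / 8) C Q ->
  (forall H, Q H != 0 -> (#|` H| <= M)%N) ->
  8 * M.+1%:R <= expR (n%:R * (t * (q%:R * alpha) / 12)) ->
  solvable (PAC C alpha) m (2 * t) 0 n.
Proof.
move=> t01 a0 qm qa Qrep QM nlarge; pose h0 : X -> bool := xpredT.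
pose mech (H : {fset (X -> bool)}) : algorithm R n m (X * bool)%type (X -> bool) :=
  @expmech R X n m q t _ (cardfs1U_gt0 h0 H).
exists (fun x => dbind Q (fun H => mech H x)); split.
  move=> x x' xx' S; rewrite adde0 !pr_dbind -ExZl ?expR_ge0//; last first.
    by move=> H; exact: pr_ge0.
  apply: le_Ex => H; have := expmech_DP q t01 (cardfs1U_gt0 h0 H) xx' S.
  by rewrite adde0.
move=> D [c Cc Dc]; rewrite success_prE.
set S := correct _ _; pose U : dist R (dataset n m (X * bool)%type) := diid n (diid m D).
have -> : Ex (diid n (diid m D)) (fun x => pr (dbind Q (fun H => mech H x)) S) =
    Ex Q (fun H => pr (dbind U (mech H)) S).
  under eq_Ex do rewrite pr_dbind.
  rewrite Ex_swap; last by move=> x H; exact: pr_ge0.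
  by apply: eq_Ex => H; rewrite pr_dbind.
pose B := [set h | (pr (dmap fst D) [set x | c x != h x] <= (alpha / 24)%:E)%E].
apply: (@le_trans _ _ (Ex Q (fun H => (7 / 8)%:E * (\1_(hit B) H)%:E))%E); last first.
  apply: le_Ex_supp => H /QM HM; rewrite indicE.
  case: (boolP (H \in hit B)) => [/set_mem[h1 h1H Bh1]|_]; last by rewrite mule0 pr_ge0.
  rewrite mule1 (_ : 7 / 8 = 1 - 1 / 8 :> R); last by lra.
  rewrite pr_setC_le pr_dbind.
  have h1err : fine (Err D h1) <= alpha / 24.
    by rewrite -lee_fin pr_fineK (le_trans (Err_le_marginal h1 Dc)).
  have h1G : h1 \in (h0 |` H)%fset by rewrite in_fset1U h1H orbT.
  have := @expmech_failure R X n m q t t01 qm D alpha _ (cardfs1U_gt0 h0 H) h1 a0 qa h1G h1err.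
  rewrite (_ : [set h | _] = ~` S); last first.
    by apply/seteqP; split=> h /=; rewrite ltNge => /negP.
  move=> /le_trans; apply; rewrite lee_fin expRN ler_pdivrMr ?expR_gt0//.
  have : #|` (h0 |` H)%fset|%:R <= M.+1%:R :> R.
    by rewrite ler_nat cardfsU1 -add1n leq_add// leq_b1.
  lra.
rewrite ExZl//; rewrite -pr_Ex; have := Qrep c Cc (dmap fst D); rewrite hitE -/B.
by rewrite -(pr_fineK Q (hit B)) -EFinM !lee_fin; lra.
Qed.

(** At a point where two concepts differ, a set with at most one member serves only one of them, but
    [3 / 4 + 3 / 4 > 1]. *)
Lemma PRDim0_subsingleton (R : realType) (X : choiceType) (C : set (X -> bool))
    (P : dist R {fset (X -> bool)}) :
  prob_representation (1 / 4) (1 / 4) C P ->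
  (forall H, P H != 0 -> (#|` H| <= 1)%N) ->
  forall c1 c2, C c1 -> C c2 -> c1 = c2.
Proof.
move=> Prep P1 c1 c2 C1 C2; apply/funext => x; apply/eqP/negPn/negP => ne.
have h1 := Prep c1 C1 (dret R x); have h2 := Prep c2 C2 (dret R x).
rewrite !hitE in h1 h2; have := leeD h1 h2.
suff : (pr P (hit (approx c1 (dret R x))) + pr P (hit (approx c2 (dret R x))) <= 1)%E.
  by move=> le1 /le_trans/(_ le1); rewrite -EFinD lee_fin; lra.
rewrite !pr_Ex -ExD; [|by move=> H; rewrite lee_fin..].
rewrite -[leRHS](Ex_cst P ler01); apply: le_Ex_supp => H /P1 HM.
rewrite -EFinD lee_fin !indicE -natrD (_ : 1 = 1%:R)// ler_nat.
case: (boolP (H \in hit (approx c1 _))) => [/set_mem[g1 g1H /approx_dret /= e1]|_]; last first.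
  by rewrite add0n leq_b1.
case: (boolP (H \in hit (approx c2 _))) => [/set_mem[g2 g2H /approx_dret /= e2]|//].
have : ([fset g1; g2] `<=` H)%fset.
  by apply/fsubsetP => g; rewrite in_fset2 => /orP[] /eqP ->.
move=> /fsubset_leq_card/leq_trans/(_ HM); rewrite cardfs2.
by case: eqP => // eg; move: ne; rewrite -e1 -e2 eg eqxx.
Qed.

Lemma subsingleton_solvable (R : realType) (X : choiceType) (C : set (X -> bool))
    (m : nat) (alpha eps : R) : 0 <= alpha -> 0 <= eps ->
  (forall c1 c2, C c1 -> C c2 -> c1 = c2) -> solvable (PAC C alpha) m eps 0 0.
Proof.
move=> a0 e0 C1.
have [c0 Cc0] : exists c0, forall c, C c -> c = c0.
  have [[c Cc]|nC] := pselect (exists c, C c).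
    by exists c => c' Cc'; exact: C1.
  by exists xpredT => c Cc; case: nC; exists c.
exists (fun=> dret R c0); split=> [x x' _ S|D [c Cc Dc]].
  by rewrite adde0 -[leLHS]mul1e lee_wpmul2r ?pr_ge0// lee_fin -expR0 ler_expR.
rewrite success_prE (_ : (fun x => _) = (fun=> 1%:E)).
  by rewrite Ex_cst// lee_fin; lra.
apply/funext => x; rewrite pr_Ex Ex_dret; last by move=> h; rewrite lee_fin.
by rewrite indicE mem_set//= -(Cc0 c Cc) Dc lee_fin.
Qed.

(** Rests on [3 / 4 <= expR (- (1 / 4))]. *)
Lemma pow34_le (R : realType) (y : R) k : 0 < y -> 4 * ln y^-1 <= k%:R ->
  (3 / 4) ^+ k <= y.
Proof.
move=> y0 yk; apply: (@le_trans _ _ (expR (- (1 / 4)) ^+ k)).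
  rewrite lerXn2r ?nnegrE ?expR_ge0//.
  by have := expR_ge1Dx (- (1 / 4) : R); lra.
by rewrite -expRM_natl -[leRHS](lnK y0) ler_expR; move: yk; rewrite lnV//; lra.
Qed.

Lemma upper_bound (R : realType) (X : choiceType) (C : set (X -> bool))
    (d alpha eps : R) (m : nat) :
  is_PRDim C d -> 0 < d -> 0 < alpha <= 1 / 4 -> 0 < eps <= 1 / 2 -> (0 < m)%N ->
  exists2 n, solvable (PAC C alpha) m eps 0 n &
    n%:R <= 275 * 194 ^+ 2 * (1 + ln (1 + d + eps^-1 + alpha^-1)) ^+ 2 *
      (d / eps + d / (eps * alpha * m%:R)).
Proof.
move=> dimC d0 /andP[a0 a4] /andP[e0 e2] m0.
have [N [P [N0 dN Prep PN]]] := PRDim_repr dimC.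
have N2 : (1 < N)%N.
  by case: N N0 dN {PN} => [//|[|//]] _ dN; rewrite dN ln1 ltxx in d0.
(* A positive [d] is [ln N] with [N >= 2]; this gap from 0 later absorbs additive constants. *)
have d2 : 1 / 2 <= d.
  apply: (@le_trans _ _ (ln 2)); last by rewrite dN le_ln_nat.
  have := @expR_ge1Dx R (- (1 / 2)); rewrite -[X in _ -> _ <= X]opprK -lnV ?posrE// => h.
  suff : ln (2^-1 : R) <= - (1 / 2) by lra.
  by rewrite -[leRHS]expRK ler_ln ?posrE ?expR_gt0//; lra.
have ai0 : 0 < alpha^-1 by rewrite invr_gt0.
have ei0 : 0 < eps^-1 by rewrite invr_gt0.
set L := 1 + ln _.
have La : 1 + ln alpha^-1 <= L by rewrite lerD2l ler_ln ?posrE//; lra.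
have L1 : 1 <= L by rewrite lerDl ln_ge0//; lra.
(* Enough rounds for [(3 / 4) ^+ k <= alpha / 24], yet [k = O(L)]. *)
pose k := (Num.truncn (4 * ln (24 / alpha))).+1.
have ln24 : ln (24 : R) <= 23.
  have -> : 24 = 1 + 23 :> R by lra.
  by apply: le_ln1Dx; lra.
have lna : ln (24 / alpha) = ln 24 + ln alpha^-1 by rewrite lnM ?posrE.
have ln24a0 : 0 <= ln (24 / alpha).
  by rewrite ln_ge0// ler_pdivlMr//; lra.
have k1 : 4 * ln (24 / alpha) <= k%:R by rewrite ltW// truncnS_gt.
have k2 : k%:R <= 97 * L.
  rewrite -[leLHS]natr1.
  have : (Num.truncn (4 * ln (24 / alpha)))%:R <= 4 * ln (24 / alpha).
    by rewrite truncn_le mulr_ge0.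
  by move=> ?; lra.
have [Q [Qrep QM]] := boosted_representation (ltn0Sn _ : (0 < k)%N) Prep PN.
set T := (2 * k)%N in QM; set M := (_ ^ _)%N in QM.
have Q24 : prob_representation (alpha / 24) (1 / 8) C Q.
  move=> c Cc D; apply: le_trans (Qrep c Cc D) _; apply: le_pr => H /= [h hH hD].
  exists h => //; apply: le_trans hD _; rewrite lee_fin; apply: pow34_le.
    by rewrite divr_gt0.
  by rewrite invf_div.
have T2 : 2 <= T%:R :> R by rewrite ler_nat /T leq_pmulr.
have TL : T%:R <= 194 * L by rewrite /T natrM; lra.
have M0 : (0 < M)%N by rewrite expn_gt0 !muln_gt0 N0.
(* The exponent the mechanism must reach, since [8 * M.+1 <= 16 * M]. *)
pose W := ln (16 * M%:R : R).
have W1 : 1 <= W.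
  apply: (@le_trans _ _ (ln (expR 1))); first by rewrite expRK.
  rewrite ler_ln ?posrE ?expR_gt0//; last by rewrite mulr_gt0// ltr0n.
  have : 1 <= M%:R :> R by rewrite ler1n.
  have := @expR_sub1_le R (1 / 2); rewrite lexx divr_ge0// => /(_ isT).
  have -> : expR 1 = expR (1 / 2) ^+ 2 :> R by rewrite -expRM_natl; congr expR; lra.
  have := expR_gt0 (1 / 2 : R); set E := expR _ => E0 E2 M1; nra.
(* Here [W = ln 16 + T (ln T + d)]; [T >= 2] and [d >= 1 / 2] absorb the rest. The factor [T ^+ 2]
   is the source of the squared logarithm. *)
have Wd : W <= 11 * T%:R ^+ 2 * d.
  have ln16 : ln (16 : R) <= 15.
    have -> : 16 = 1 + 15 :> R by lra.
    by apply: le_ln1Dx; lra.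
  have T0 : 0 < T%:R :> R by lra.
  have lnT : ln (T%:R : R) <= T%:R.
    have /le_ln1Dx : -1 < T%:R - 1 :> R by lra.
    by rewrite addrC subrK => ?; lra.
  have -> : W = ln 16 + T%:R * (ln T%:R + d).
    rewrite /W lnM ?posrE ?ltr0n// /M natrX lnXn ?ltr0n ?muln_gt0 ?N0//.
    by rewrite natrM lnM ?posrE ?ltr0n// -dN mulr_natl.
  have : T%:R * (ln T%:R + d) <= T%:R * (T%:R + d) by rewrite ler_wpM2l ?lerD2r// ltW.
  move: T2 d2; set v := T%:R => T2 d2 h.
  have v4 : 4 <= v * v by nra.
  have vd : 0 <= v * v * (2 * d - 1) by rewrite mulr_ge0//; lra.
  have vd' : 0 <= v * d * (v - 1) by rewrite !mulr_ge0//; lra.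
  rewrite expr2; lra.
(* This choice keeps [q alpha <= 2] and gives [1 / (q alpha) <= 1 + 1 / (m alpha)], the origin of
   the two terms of the rate. *)
pose q := minn m (Num.truncn alpha^-1).+1.
have qm : (q <= m)%N by rewrite geq_minl.
have q0 : (0 < q)%N by rewrite leq_min m0.
have tr : (Num.truncn alpha^-1)%:R <= alpha^-1 by rewrite truncn_le ltW.
have aa : alpha^-1 * alpha = 1 by rewrite mulVf// gt_eqF.
have qa : q%:R * alpha <= 2.
  have : q%:R <= alpha^-1 + 1.
    apply: (@le_trans _ _ ((Num.truncn alpha^-1).+1%:R)); first by rewrite ler_nat geq_minr.
    by rewrite -natr1 lerD2r.
  by rewrite -(ler_pM2r a0) mulrDl aa; lra.
have qa0 : 0 < q%:R * alpha by rewrite mulr_gt0// ltr0n.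
have ma0 : 0 < m%:R * alpha by rewrite mulr_gt0// ltr0n.
have qinv : (q%:R * alpha)^-1 <= 1 + (m%:R * alpha)^-1.
  rewrite /q /minn; case: ifP => _; first by rewrite lerDr.
  have q1 : 1 <= (Num.truncn alpha^-1).+1%:R * alpha.
    by rewrite -[leLHS]aa ler_pM2r// ltW// truncnS_gt.
  apply: (@le_trans _ _ 1); first by rewrite invf_le1// (lt_le_trans ltr01).
  by rewrite lerDl invr_ge0 ltW.
(* With [t = eps / 2], the exponent [n t q alpha / 12] reaches [W] as soon as [n >= r]. *)
pose r := 24 * W / (eps * (q%:R * alpha)).
have r0 : 0 <= r by rewrite divr_ge0 ?mulr_ge0 ?(ltW qa0) ?(ltW e0)//; lra.
exists (Num.truncn r).+1.
  rewrite (_ : eps = 2 * (eps / 2)); last by lra.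
  apply: (@representation_solvable R X C Q M _ m q alpha) => //.
  - by apply/andP; split; lra.
  apply: (@le_trans _ _ (expR W)).
    rewrite lnK ?posrE ?mulr_gt0 ?ltr0n//.
    have : 1 <= M%:R :> R by rewrite ler1n.
    by rewrite -natr1; lra.
  rewrite ler_expR; have rn : r <= (Num.truncn r).+1%:R by rewrite ltW// truncnS_gt.
  have eq0 : 0 < eps * (q%:R * alpha) by rewrite mulr_gt0.
  move: rn; rewrite ler_pdivrMr//; lra.
apply: (@le_trans _ _ (r + 1)).
  by rewrite -[leLHS]natr1 lerD2r truncn_le.
have -> : d / eps + d / (eps * alpha * m%:R) = d / eps * (1 + (m%:R * alpha)^-1).
  by rewrite mulrDr mulr1 -[eps * alpha * _]mulrA [alpha * _]mulrC invfM !mulrA.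
set V := 1 + _ in qinv *.
have V1 : 1 <= V by rewrite /V lerDl invr_ge0 ltW.
have ei1 : 1 <= eps^-1 by rewrite invf_ge1//; lra.
have rW : r <= 24 * (W * (eps^-1 * V)).
  by rewrite /r invfM -!mulrA !ler_pM2l//; lra.
have X1 : 1 <= eps^-1 * V by rewrite mulr_ege1.
have X0 : 0 < eps^-1 * V by lra.
have WX : 1 <= W * (eps^-1 * V) by rewrite mulr_ege1.
(* Rounding up costs 1, absorbed by turning 24 into 25; then [275 = 25 * 11]. *)
apply: (@le_trans _ _ (25 * (W * (eps^-1 * V)))); first by lra.
have T2L : T%:R ^+ 2 <= 194 ^+ 2 * L ^+ 2.
  by rewrite -exprMn lerXn2r ?nnegrE//; lra.
have WL : W <= 11 * (194 ^+ 2 * L ^+ 2) * d.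
  by apply: (le_trans Wd); rewrite ler_pM2r// ler_pM2l.
have := WL; rewrite -(ler_pM2r X0) => WL'.
have -> : 275 * 194 ^+ 2 * L ^+ 2 * (d / eps * V) =
  25 * (11 * (194 ^+ 2 * L ^+ 2) * d * (eps^-1 * V)) by lra.
by rewrite ler_pM2l.
Qed.

(** * Existence of the sample complexity and the two-sided estimate *)

Lemma solvable_min (R : realType) (Z O : choiceType) (T : task R Z O) m (eps delta : R) n1 :
  solvable T m eps delta n1 ->
  exists2 n, is_sample_complexity T m eps delta n & (n <= n1)%N.
Proof.
move=> s1.
have exn : exists n, `[< solvable T m eps delta n >] by exists n1; apply/asboolP.
case: (ex_minnP exn) => n /asboolP sn nmin; exists n; last exact/nmin/asboolP.
by split=> // n' /asboolP; exact: nmin.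
Qed.

Theorem theorem1p4 (R : realType) :
  exists (alpha0 eps0 K : R) (k : nat),
    [/\ 0 < alpha0, 0 < eps0, 0 < K &
    forall (X : choiceType) (C : set (X -> bool)) (d : R),
      is_PRDim C d ->
    forall (alpha eps : R) (m : nat),
      0 < alpha <= alpha0 -> 0 < eps <= eps0 -> (0 < m)%N ->
    exists n : nat,
      let g := d / eps + d / (eps * alpha * m%:R) in
      let polylog := K * (1 + ln (1 + d + eps^-1 + alpha^-1)) ^+ k in
      [/\ is_sample_complexity (PAC C alpha) m eps 0 n,
          n%:R <= polylog * g &
          ~ complementary_pair C -> g / polylog <= n%:R]].
Proof.
exists (1 / 4), (1 / 2), (275 * 194 ^+ 2), 2%N; split.
- by rewrite divr_gt0.
- by rewrite divr_gt0.
- by rewrite mulr_gt0// exprn_gt0.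
move=> X C d dimC alpha eps m a01 e01 m0.
have [N [P [N0 dN Prep PN]]] := PRDim_repr dimC.
case/andP: (a01) => a0 _; case/andP: (e01) => e0 _.
(* For [d = 0] the rate vanishes, so [n = 0] is required; [C] then has at most one concept and a
   constant answer works. *)
have [d0|d0] := eqVneq d 0.
  have N1 : N = 1%N.
    apply/eqP; rewrite eqn_leq N0 andbT leqNgt; apply/negP => N2.
    by have := @ln_gt0 R N%:R; rewrite -dN d0 ltxx ltr1n => /(_ N2).
  exists 0%N => /=; rewrite d0 !mul0r !addr0 mulr0 mul0r; split=> //.
  split=> //; apply: subsingleton_solvable; [exact: ltW..|].
  by apply: (PRDim0_subsingleton Prep) => H /PN; rewrite N1.
have {}d0 : 0 < d by rewrite lt0r d0 dN ln_ge0// ler1n.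
have [n1 s1 n1le] := upper_bound dimC d0 a01 e01 m0.
have [n sc nn1] := solvable_min s1; exists n => /=; split=> //.
  by apply: le_trans n1le; rewrite ler_nat.
move=> ncp; have lb := lower_bound dimC d0 ncp a01 e01 m0 sc.1.
have L1 : 1 <= 1 + ln (1 + d + eps^-1 + alpha^-1).
  have ai0 : 0 < alpha^-1 by rewrite invr_gt0.
  have ei0 : 0 < eps^-1 by rewrite invr_gt0.
  by rewrite lerDl ln_ge0//; lra.
have L2 : 1 <= (1 + ln (1 + d + eps^-1 + alpha^-1)) ^+ 2 by rewrite exprn_ege1.
move: L2; set V := _ ^+ 2 => V1.
have n0 : 0 <= n%:R :> R by [].
have nV : n%:R <= n%:R * V by rewrite ler_peMr.
(* [K] exceeds 441 and the squared logarithm is at least 1, so dividing by the polylogarithm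
   suffices. *)
rewrite ler_pdivrMr; last by rewrite !mulr_gt0// ?exprn_gt0//; lra.
apply: (le_trans lb); lra.
Qed.
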